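(* For every $\delta\in\Delta$, the subspace $V_\delta$ is a nonzero, proper subspace of $V$ stabilized by $P_\delta$.
   Context: $k$ is a field of characteristic zero. $\Phi$ is a reduced root system and $G$ is the split simply connected semisimple group over $k$ with root system $\Phi$, with split maximal torus $T$, root homomorphisms $x_\alpha\colon\mathbb G_a\to G$ ($\alpha\in\Phi$) and root subgroups $\mathfrak X_\alpha=\mathrm{im}\,x_\alpha$. $\Delta$ is a set of simple roots in $\Phi$ (the same symbol is used for the Dynkin diagram), and $B$ is the Borel subgroup generated by $T$ and the $\mathfrak X_\rho$ for $\rho$ a positive root. For $\delta\in\Delta$, $P_\delta$ is the standard maximal proper parabolic subgroup corresponding to $\delta$, i.e. the subgroup generated by $B$ and the $\mathfrak X_{-\alpha}$ for $\alpha\in\Delta\setminus\{\delta\}$. Fix $\beta\in\Delta$; $\omega$ is the corresponding fundamental weight, $V$ is the irreducible representation of $G$ with highest weight $\omega$ (with respect to $T$ and $B$), and $v^+$ is a highest weight vector in $V$. For $\delta\in\Delta\setminus\{\beta\}$, the $\delta$-component of $\Delta$ is the connected component of $\beta$ in $\Delta\setminus\{\delta\}$; the $\beta$-component is the empty set. For a root $\rho=\sum_{\alpha\in\Delta}c_\alpha\alpha$ with integers $c_\alpha$, the $\delta$-height of $\rho$ is $\sum c_\alpha$ taken over the simple roots $\alpha$ not in the $\delta$-component. $L_\delta$ is the subgroup of $G$ generated by the $\mathfrak X_\rho$ for roots $\rho$ of $\delta$-height zero, and $V_\delta$ is the subspace of $V$ spanned by the $L_\delta$-orbit of $v^+$.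 (So $L_\beta$ is trivial and $V_\beta=kv^+$.)
   Formalization: Properness of V_δ is claimed only when β and δ lie in the same connected component of the Dynkin diagram (automatic for irreducible Φ); otherwise V_δ = V, e.g. for SL_2×SL_2 acting on k² through the factor of β. *)

(* Defs.v *)
From HB Require Import structures.
From mathcomp Require Import all_boot all_order all_algebra.

Set Implicit Arguments.
Unset Strict Implicit.
Unset Printing Implicit Defensive.

Import GRing.Theory.
Local Open Scope ring_scope.

Definition pairing r (x y : 'rV[int]_r) : int := \sum_i x 0 i * y 0 i.

(* A root datum whose character lattice X and cocharacter lattice Y are both
   identified with Z^r, in dual bases. The value of [coroot] outside [roots]
   is irrelevant. *)
Record root_datum := RootDatum {
  rk : nat;
  roots : seq 'rV[int]_rk;
  coroot : 'rV[int]_rk -> 'rV[int]_rk;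
  roots_uniq : uniq roots;
  coroot_inj : {in roots &, injective coroot};
  pairing_coroot : {in roots, forall a, pairing a (coroot a) = 2};
  roots_reflection :
    {in roots &, forall a b, b - a *~ pairing b (coroot a) \in roots};
  coroots_reflection :
    {in roots &, forall a b,
      coroot b - coroot a *~ pairing a (coroot b) \in map coroot roots}
}.

Definition reduced (D : root_datum) : Prop :=
  {in roots D &, forall a b,
    (exists m n : int, [/\ m != 0, n != 0 & a *~ m = b *~ n]) ->
    b = a \/ b = - a}.

Definition int_span r (s : seq 'rV[int]_r) (x : 'rV[int]_r) : Prop :=
  exists c : 'rV[int]_r -> int, x = \sum_(a <- s) a *~ c a.

(* The roots span the rational vector space X (x) Q. *)
Definition semisimple (D : root_datum) : Prop :=
  forall x : 'rV[int]_(rk D),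
    exists2 m : nat, (0 < m)%N & int_span (roots D) (x *+ m).

(* The coroots generate Y; dually, if D is semisimple, X is the full weight
   lattice of the root system. *)
Definition simply_connected (D : root_datum) : Prop :=
  forall y : 'rV[int]_(rk D), int_span (map (@coroot D) (roots D)) y.

Section SimpleRoots.
Variables (D : root_datum) (l : nat) (Delta : 'I_l -> 'rV[int]_(rk D)).

Record simple_roots : Prop := SimpleRoots {
  simple_root : forall i, Delta i \in roots D;
  simple_free : forall c : 'I_l -> int,
    \sum_i Delta i *~ c i = 0 -> forall i, c i = 0;
  simple_gen : {in roots D, forall rho, exists c : 'I_l -> nat,
    rho = \sum_i Delta i *+ c i \/ rho = - \sum_i Delta i *+ c i}
}.

Definition positive_root (rho : 'rV[int]_(rk D)) : Prop :=
  rho \in roots D /\ exists c : 'I_l -> nat, rho = \sum_i Delta i *+ c i.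

Definition dynkin : rel 'I_l :=
  [rel i j | (i != j) && (pairing (Delta i) (coroot (Delta j)) != 0)].

Definition component (beta delta : 'I_l) : {set 'I_l} :=
  if delta == beta then set0
  else [set i | connect
         [rel i j | [&& dynkin i j, i != delta & j != delta]] beta i].

(* [rho] has delta-height [h]; the coefficients c are unique. *)
Definition delta_height (beta delta : 'I_l) (rho : 'rV[int]_(rk D)) (h : int) :
    Prop :=
  exists2 c : 'I_l -> int, rho = \sum_i Delta i *~ c i &
    h = \sum_(i | i \notin component beta delta) c i.

Definition fundamental_weight (beta : 'I_l) (w : 'rV[int]_(rk D)) : Prop :=
  forall i, pairing w (coroot (Delta i)) = (i == beta)%:Z.

End SimpleRoots.

Section Functors.
Variable k : fieldType.

(* Functors of points on commutative k-algebras; those of MathComp are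
   nonzero, which loses nothing since G(0) is trivial for affine G. *)
Record group_functor := GroupFunctor {
  pts :> comAlgType k -> Type;
  gone : forall R, pts R;
  gmul : forall R, pts R -> pts R -> pts R;
  ginv : forall R, pts R -> pts R;
  gmap : forall R S : comAlgType k, {lrmorphism R -> S} -> pts R -> pts S;
  gmulA : forall R, associative (@gmul R);
  gmul1 : forall R, left_id (gone R) (@gmul R);
  gmulV : forall R, left_inverse (gone R) (@ginv R) (@gmul R);
  gmap_mul : forall (R S : comAlgType k) (f : {lrmorphism R -> S}),
    {morph gmap f : x y / gmul x y >-> gmul x y};
  gmap_id : forall (R : comAlgType k) (f : {lrmorphism R -> R}), f =1 id -> gmap f =1 id;
  gmap_comp : forall (R S U : comAlgType k) (f : {lrmorphism R -> S}) (g : {lrmorphism S -> U})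
      (h : {lrmorphism R -> U}),
    h =1 g \o f -> gmap h =1 gmap g \o gmap f
}.

Record group_hom (G H : group_functor) := GroupHom {
  hom_fun :> forall R, G R -> H R;
  hom_mul : forall R, {morph @hom_fun R : x y / gmul x y >-> gmul x y};
  hom_nat : forall (R S : comAlgType k) (f : {lrmorphism R -> S}) x,
    hom_fun (gmap f x) = gmap f (hom_fun x)
}.

(* An affine algebraic group: by Yoneda, the universal point identifies G with
   the functor represented by the finitely generated algebra [coord]. *)
Record alg_group := AlgGroup {
  gfun :> group_functor;
  coord : comAlgType k;
  univ : gfun coord;
  univ_surj : forall R (g : gfun R),
    exists f : {lrmorphism coord -> R}, gmap f univ = g;
  univ_inj : forall (R : comAlgType k) (f f' : {lrmorphism coord -> R}),
    gmap f univ = gmap f' univ -> f =1 f';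
  coord_fin_gen : exists s : seq coord, forall P : coord -> Prop,
    P 1 -> (forall (c : k) a, P a -> P (c *: a)) ->
    (forall a b, P a -> P b -> P (a + b)) ->
    (forall a b, P a -> P b -> P (a * b)) ->
    {in s, forall a, P a} -> forall a, P a
}.

Definition subfunctor (G : group_functor) :=
  forall R : comAlgType k, G R -> Prop.

Record closed_subgroup (G : alg_group) (H : subfunctor G) : Prop :=
  ClosedSubgroup {
  closed_one : forall R, H R (gone G R);
  closed_mul : forall R x y, H R x -> H R y -> H R (gmul x y);
  closed_inv : forall R x, H R x -> H R (ginv x);
  closed_zeros : exists I : coord G -> Prop,
    forall (R : comAlgType k) (f : {lrmorphism coord G -> R}),
      H R (gmap f (univ G)) <-> forall a, I a -> f a = 0
}.

Definition generated (G : alg_group) (S : subfunctor G) : subfunctor G :=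
  fun R g => forall H : subfunctor G, closed_subgroup H ->
    (forall R' g', S R' g' -> H R' g') -> H R g.

Definition Ga : group_functor.
Proof.
refine (@GroupFunctor (fun R => (R : Type)) (fun R => 0) (fun R x y => x + y)
  (fun R x => - x) (fun R S f => f) _ _ _ _ _ _).
- by move=> R x y z; rewrite addrA.
- by move=> R x; rewrite add0r.
- by move=> R x; rewrite addNr.
- by move=> R S f x y; rewrite rmorphD.
- by move=> R f e x; rewrite e.
- by move=> R S U f g h e x; rewrite e.
Defined.

(* Points of G_m^r: r-tuples of units together with their inverses. *)
Section Torus.
Variable r : nat.
Definition torus_pt (R : comAlgType k) : Type :=
  {p : 'rV[R]_r * 'rV[R]_r | [forall i, p.1 0 i * p.2 0 i == 1]}.

Definition torus_mk (R : comAlgType k) (u v : 'I_r -> R)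
    (uv : forall i, u i * v i = 1) : torus_pt R.
Proof.
exists (\row_i u i, \row_i v i).
by apply/forallP => i /=; rewrite !mxE uv.
Defined.

Definition tval (R : comAlgType k) (t : torus_pt R) (i : 'I_r) : R :=
  (val t).1 0 i.
Definition tinv (R : comAlgType k) (t : torus_pt R) (i : 'I_r) : R :=
  (val t).2 0 i.

Lemma tvalV (R : comAlgType k) (t : torus_pt R) i : tval t i * tinv t i = 1.
Proof. by have /forallP/(_ i)/eqP := valP t. Qed.

Lemma torus_eq (R : comAlgType k) (s t : torus_pt R) :
  tval s =1 tval t -> s = t.
Proof.
move=> e; have e' : tinv s =1 tinv t.
  move=> i; rewrite -[LHS]mul1r -(tvalV t i) -e mulrAC [tval s i * _]mulrC.
  by rewrite [_ * tval s i]mulrC tvalV mul1r.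
apply: val_inj; case: s t e e' => [[u v] uv] [[u' v'] uv'] e e' /=.
by congr (_, _); apply/rowP => i; [exact: e | exact: e'].
Qed.

Lemma torus_mul_subproof (R : comAlgType k) (s t : torus_pt R) i :
  (tval s i * tval t i) * (tinv s i * tinv t i) = 1.
Proof. by rewrite mulrACA !tvalV mulr1. Qed.

Lemma torus_inv_subproof (R : comAlgType k) (s : torus_pt R) i :
  tinv s i * tval s i = 1.
Proof. by rewrite mulrC tvalV. Qed.

Lemma torus_map_subproof (R S : comAlgType k) (f : {lrmorphism R -> S})
  (s : torus_pt R) i : f (tval s i) * f (tinv s i) = 1.
Proof. by rewrite -rmorphM tvalV rmorph1. Qed.

Lemma tval_mk (R : comAlgType k) (u v : 'I_r -> R) uv :
  tval (@torus_mk R u v uv) =1 u.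
Proof. by move=> i; rewrite /tval /= mxE. Qed.

Definition torus : group_functor.
Proof.
refine (@GroupFunctor torus_pt
  (fun R => torus_mk (fun i : 'I_r => mulr1 (1 : R)))
  (fun R s t => torus_mk (torus_mul_subproof s t))
  (fun R s => torus_mk (torus_inv_subproof s))
  (fun R S f s => torus_mk (torus_map_subproof f s)) _ _ _ _ _ _).
- by move=> R x y z; apply: torus_eq => i; rewrite !tval_mk mulrA.
- by move=> R x; apply: torus_eq => i; rewrite !tval_mk mul1r.
- by move=> R x; apply: torus_eq => i; rewrite !tval_mk mulrC tvalV.
- by move=> R S f x y; apply: torus_eq => i; rewrite !tval_mk rmorphM.
- by move=> R f e x; apply: torus_eq => i; rewrite !tval_mk e.
- by move=> R S U f g h e x; apply: torus_eq => i; rewrite !tval_mk e.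
Defined.
End Torus.

Notation Gm := (torus 1).

(* u ^ z for an integer z, where v is the inverse of u *)
Definition zpow (R : comAlgType k) (u v : R) (z : int) : R :=
  match z with Posz n => u ^+ n | Negz n => v ^+ n.+1 end.

Lemma zpowV (R : comAlgType k) (u v : R) z :
  u * v = 1 -> zpow u v z * zpow v u z = 1.
Proof. by move=> uv; case: z => n /=; rewrite -exprMn ?[v * u]mulrC uv expr1n. Qed.

Definition character r (x : 'rV[int]_r) (R : comAlgType k) (t : torus r R) : R :=
  \prod_i zpow (tval t i) (tinv t i) (x 0 i).

Definition cocharacter r (y : 'rV[int]_r) (R : comAlgType k) (t : Gm R) :
    torus r R :=
  torus_mk (fun i => zpowV (y 0 i) (tvalV t ord0)).

Definition mx2 (R : comAlgType k) (a b c d : R) : 'M[R]_2 :=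
  \matrix_(i, j) if i == ord0 then (if j == ord0 then a else b)
                 else (if j == ord0 then c else d).

Lemma det_mx2 (R : comAlgType k) (a b c d : R) :
  \det (mx2 a b c d) = a * d - b * c.
Proof.
rewrite (expand_det_row _ ord0) !big_ord_recl big_ord0 addr0.
rewrite /cofactor !det_mx11 !mxE /= expr0 mul1r /bump /= expr1 mulN1r.
by rewrite mulrN.
Qed.

Definition SL2_pt (R : comAlgType k) : Type := {M : 'M[R]_2 | \det M == 1}.

Definition SL2 : group_functor.
Proof.
refine (@GroupFunctor SL2_pt
  (fun R => exist _ 1%:M _)
  (fun R M N => exist _ (val M *m val N) _)
  (fun R M => exist _ (\adj (val M)) _)
  (fun R S f M => exist _ (map_mx f (val M)) _) _ _ _ _ _ _).
- by move=> R x y z; apply: val_inj; rewrite /= mulmxA.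
- by move=> R x; apply: val_inj; rewrite /= mul1mx.
- move=> R x; apply: val_inj; rewrite /= mul_adj_mx.
  by rewrite (eqP (valP x)).
- by move=> R S f x y; apply: val_inj; rewrite /= map_mxM.
- by move=> R f e x; apply: val_inj; apply/matrixP => i j; rewrite /= mxE e.
- by move=> R S U f g h e x; apply: val_inj; apply/matrixP => i j;
    rewrite /= !mxE e.
Unshelve.
- by rewrite /= det1.
- by rewrite /= det_mulmx (eqP (valP M)) (eqP (valP N)) mulr1.
- have := congr1 determinant (mul_adj_mx (val M)).
  by rewrite det_mulmx (eqP (valP M)) det1 mulr1 => ->.
- by rewrite /= det_map_mx (eqP (valP M)) rmorph1.
Defined.

Definition SL2_mk (R : comAlgType k) (a b c d : R) (e : a * d - b * c = 1) :
  SL2 R := exist _ (mx2 a b c d) (introT eqP (etrans (det_mx2 a b c d) e)).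

Lemma upper_subproof (R : comAlgType k) (a : R) : 1 * 1 - a * 0 = 1.
Proof. by rewrite mulr0 subr0 mulr1. Qed.
Lemma lower_subproof (R : comAlgType k) (a : R) : 1 * 1 - 0 * a = 1.
Proof. by rewrite mul0r subr0 mulr1. Qed.
Lemma diag_subproof (R : comAlgType k) (t : Gm R) :
  tval t ord0 * tinv t ord0 - 0 * 0 = 1.
Proof. by rewrite mul0r subr0 tvalV. Qed.

Definition upper (R : comAlgType k) (a : R) : SL2 R := SL2_mk (upper_subproof a).
Definition lower (R : comAlgType k) (a : R) : SL2 R := SL2_mk (lower_subproof a).
Definition diag (R : comAlgType k) (t : Gm R) : SL2 R := SL2_mk (diag_subproof t).

Definition dual_numbers : comAlgType k := {poly %/ ('X^2 : {poly k})}.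
Definition eps : dual_numbers := 'qX.

Lemma eps2 : eps * eps = 0.
Proof.
rewrite /eps /qpolyX -in_qpolyM -expr2; apply: val_inj => /=.
by rewrite mk_monic_Xn Pdiv.RingMonic.rmodpp ?monicXn.
Qed.

Lemma torus_eps_subproof r (h : 'rV[k]_r) (i : 'I_r) :
  (1 + h 0 i *: eps) * (1 - h 0 i *: eps) = 1.
Proof.
by rewrite mulrC -subr_sqr expr1n expr2 -scalerAl -scalerAr eps2 !scaler0 subr0.
Qed.

Definition torus_eps r (h : 'rV[k]_r) : torus r dual_numbers :=
  torus_mk (torus_eps_subproof h).

(* Lie(G) is the kernel of G(k[eps]) -> G(k); note that there is exactly one
   k-algebra morphism k[eps] -> k. *)
Definition in_Lie (G : group_functor) (g : G dual_numbers) : Prop :=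
  forall p : {lrmorphism dual_numbers -> (k^o : comAlgType k)},
    gmap p g = gone G _.

(* The element h + sum_(a in s) c_a dx_a(1) of Lie(G) *)
Definition Lie_elt (G : group_functor) r (tau : group_hom (torus r) G)
    (s : seq 'rV[int]_r) (x : 'rV[int]_r -> group_hom Ga G)
    (h : 'rV[k]_r) (c : 'rV[int]_r -> k) : G dual_numbers :=
  gmul (tau dual_numbers (torus_eps h))
    (foldr (fun a g => gmul (x a dual_numbers (c a *: eps : Ga dual_numbers)) g)
       (gone G dual_numbers) s).

(* A split group with root datum D, together with its split maximal torus
   T = G_m^r and its root homomorphisms x_a: Lie(G) is the direct sum of Lie(T)
   and of the images of the dx_a (the root spaces, by [xroot_conj]), for each
   root a there is a homomorphism SL_2 -> G attached to x_a, x_(-a) and the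
   coroot of a, and T and the root subgroups generate G. In characteristic zero
   this forces G to be smooth, connected and reductive and T to be maximal.
   The homomorphisms x_a are not required to be normalized with respect to
   each other, hence the constant c. The value of [xroot] outside the roots is
   irrelevant. *)
Record split_group (D : root_datum) := SplitGroup {
  sgroup :> alg_group;
  maxtorus : group_hom (torus (rk D)) sgroup;
  xroot : 'rV[int]_(rk D) -> group_hom Ga sgroup;
  maxtorus_inj : forall R, injective (maxtorus R);
  xroot_inj : {in roots D, forall a R, injective (xroot a R)};
  xroot_conj : {in roots D, forall a R (t : torus (rk D) R) (u : Ga R),
    gmul (gmul (maxtorus R t) (xroot a R u)) (ginv (maxtorus R t)) =
    xroot a R (character a t * u)};
  sgroup_Lie : forall g : sgroup dual_numbers, in_Lie g ->
    exists h c, g = Lie_elt maxtorus (roots D) xroot h c;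
  sgroup_Lie_direct : forall h c,
    Lie_elt maxtorus (roots D) xroot h c = gone sgroup _ ->
    h = 0 /\ {in roots D, forall a, c a = 0};
  sgroup_SL2 : {in roots D, forall a,
    exists (phi : group_hom SL2 sgroup) (c : k), [/\ c != 0,
      forall (R : comAlgType k) (u : R), phi R (upper u) = xroot a R u,
      forall (R : comAlgType k) (u : R), phi R (lower u) = xroot (- a) R (c *: u) &
      forall (R : comAlgType k) (t : Gm R),
        phi R (diag t) = maxtorus R (cocharacter (coroot a) t)]};
  sgroup_gen : forall R (g : sgroup R),
    generated (fun R' g' =>
      (exists t, g' = maxtorus R' t) \/
      (exists a u, a \in roots D /\ g' = xroot a R' u)) g
}.

Section Subgroups.
Variables (D : root_datum) (G : split_group D) (l : nat).
Variable Delta : 'I_l -> 'rV[int]_(rk D).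

Definition torus_subgroup : subfunctor G := fun R g => exists t, g = maxtorus G R t.

Definition root_subgroup (a : 'rV[int]_(rk D)) : subfunctor G :=
  fun R g => exists u : Ga R, g = xroot G a R u.

Definition borel : subfunctor G :=
  generated (fun R g => torus_subgroup g \/
    exists2 rho, positive_root Delta rho & root_subgroup rho g).

Definition parabolic (delta : 'I_l) : subfunctor G :=
  generated (fun R g => borel g \/
    exists2 i, i != delta & root_subgroup (- Delta i) g).

Definition Lsub (beta delta : 'I_l) : subfunctor G :=
  generated (fun R g => exists rho, [/\ rho \in roots D,
    delta_height Delta beta delta rho 0 & root_subgroup rho g]).

End Subgroups.

(* Finite-dimensional representations, on k^n; G acts on column vectors. *)
Record representation (G : group_functor) (n : nat) := Representation {
  rep :> forall R, G R -> 'M[R]_n;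
  rep1 : forall R, rep (gone G R) = 1%:M;
  repM : forall R (g h : G R), rep (gmul g h) = rep g *m rep h;
  rep_nat : forall (R S : comAlgType k) (f : {lrmorphism R -> S}) (g : G R),
    rep (gmap f g) = map_mx f (rep g)
}.

Section Rep.
Variable n : nat.

(* v (x) 1 in V (x) R *)
Definition vec_ext (R : comAlgType k) (v : 'cV[k]_n) : 'cV[R]_n :=
  map_mx (in_alg R) v.

(* u lies in the image of U (x) R in R^n *)
Definition in_ext (U : {vspace 'cV[k]_n}) (R : comAlgType k) (u : 'cV[R]_n) :
    Prop :=
  exists (m : nat) (c : 'I_m -> R) (w : 'I_m -> 'cV[k]_n),
    (forall i, w i \in U) /\ u = \sum_i c i *: vec_ext R (w i).

Variables (G : group_functor) (V : representation G n).

Definition stabilizes (H : subfunctor G) (U : {vspace 'cV[k]_n}) : Prop :=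
  forall R (g : G R), H R g ->
  forall u : 'cV[R]_n, in_ext U u -> in_ext U (V R g *m u).

Definition irreducible : Prop :=
  (0 < n)%N /\ forall U : {vspace 'cV[k]_n},
    stabilizes (fun _ _ => True) U -> U = 0%VS \/ U = fullv.

(* The span of the orbit of an algebraic group, not of its group of k-points:
   the orbit consists of the vectors H(R).v in V (x) R for all R. In
   characteristic zero H(k) gives the same span for the groups H considered
   here. *)
Definition orbit_span (H : subfunctor G) (v w : 'cV[k]_n) : Prop :=
  forall U : {vspace 'cV[k]_n},
    (forall R (g : G R), H R g -> in_ext U (V R g *m vec_ext R v)) -> w \in U.

End Rep.

Section HighestWeight.
Variables (D : root_datum) (G : split_group D) (l : nat).
Variable Delta : 'I_l -> 'rV[int]_(rk D).
Variables (n : nat) (V : representation G n).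

Definition has_weight (w : 'rV[int]_(rk D)) (v : 'cV[k]_n) : Prop :=
  forall R (t : torus (rk D) R),
    V R (maxtorus G R t) *m vec_ext R v = character w t *: vec_ext R v.

Record highest_weight_vector (w : 'rV[int]_(rk D)) (v : 'cV[k]_n) : Prop :=
  HighestWeightVector {
  hwv_neq0 : v != 0;
  hwv_weight : has_weight w v;
  hwv_fixed : forall rho, positive_root Delta rho ->
    forall R (g : G R), root_subgroup rho g ->
      V R g *m vec_ext R v = vec_ext R v
}.

Definition Vsub (beta delta : 'I_l) (v : 'cV[k]_n) : 'cV[k]_n -> Prop :=
  orbit_span V (Lsub Delta beta delta) v.

End HighestWeight.
End Functors.

(* Main.v *)
(* Let E_a be the operator of V by which the root subgroup of a acts to first
   order; in characteristic zero it determines the action of the root subgroup.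
   Conjugating an element of Lie(G) by root subgroups and comparing weights gives
   [E_a, E_b] = c E_(a+b), and 0 if a + b is a nonzero non-root. Let U be the span
   of the vectors obtained from v by the E_s with s a root of L_delta. As k is
   infinite, U = V_delta. The torus acts by a scalar on each of these vectors. A
   positive root which is not a root of L_delta kills v and, because such roots
   are stable under adding roots of L_delta, kills U. For a simple root a outside
   the delta-component, a <> delta, E_(-a) commutes with the E_s and kills v by a
   computation in SL_2, hence kills U. So P_delta stabilizes U.
   If U = V, then E_delta = 0. When E_j = 0, SL_2 shows that the coroot of j acts
   trivially, hence E_i = 0 for every i with <i, coroot j> <> 0. Following a path
   from delta to beta, the coroot of beta acts trivially on v, although it acts
   with weight 1. *)
From Stdlib Require Import Classical_Prop.
From HB Require Import structures.
Require Import Defs.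
From mathcomp Require Import all_boot all_order all_algebra ring.
Import Defs GRing.Theory Order.TTheory Num.Theory.
Local Open Scope ring_scope.

Set Implicit Arguments.
Unset Strict Implicit.
Unset Printing Implicit Defensive.

(** * Polynomials over a field of characteristic zero *)

Section CharZero.
Variable k : fieldType.
Hypothesis char0 : [pchar k] =i pred0.

Lemma char0_natr_inj : injective (fun i : nat => i%:R : k).
Proof.
have wlg i j : (i <= j)%N -> i%:R = j%:R :> k -> i = j.
  move=> lij /eqP; rewrite eq_sym -subr_eq0 -natrB //.
  by rewrite (proj1 (pcharf0P k) char0) subn_eq0 => lji; apply/eqP; rewrite eqn_leq lij.
by move=> i j e; case/orP: (leq_total i j) => /wlg; [apply | move/(_ (esym e))].
Qed.

Lemma char0_natS_neq0 i : i.+1%:R != 0 :> k.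
Proof. by rewrite (proj1 (pcharf0P k) char0). Qed.

(** In characteristic zero the scalar 2 has infinite order, so it separates integer exponents; it is
    the test value for characters of the torus. *)
Lemma expz2_inj (m : int) : (2%:R : k) ^ m = 1 -> m = 0.
Proof.
have two_pow p : (2%:R : k) ^+ p.+1 = 1 -> False.
  rewrite -natrX -[1]/(1%:R) => /char0_natr_inj/eqP.
  by rewrite expnS gtn_eqF // leq_pmulr // expn_gt0.
case: m => [[|p]|p] //=; first by rewrite -exprnP => /two_pow.
by rewrite NegzE -exprnN => /(congr1 GRing.inv); rewrite invrK invr1 => /two_pow.
Qed.

(** Interpolation at 1, ..., N, where the Vandermonde matrix is invertible because these nodes are
    distinct in [k]. They are also nonzero, so values at nonzero scalars suffice. *)
Lemma poly_coef_points N (m : 'I_N) : exists a : 'I_N -> k,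
  forall p : {poly k}, (size p <= N)%N -> p`_m = \sum_i a i * p.[i.+1%:R].
Proof.
pose W := Vandermonde N (\row_(i < N) (i.+1%:R : k)).
have Wunit : W \in unitmx.
  rewrite unitmxE det_Vandermonde unitfE prodf_seq_neq0; apply/allP => i _ /=.
  rewrite prodf_seq_neq0; apply/allP => j _; apply/implyP => ltij.
  rewrite !mxE subr_eq0; apply/eqP => /char0_natr_inj [e].
  by rewrite e ltnn in ltij.
pose a := invmx W *m delta_mx m 0 : 'cV[k]_N.
exists (fun i => a i 0) => p sp.
have Wa (j : 'I_N) : \sum_i a i 0 * i.+1%:R ^+ j = (j == m)%:R.
  have := congr1 (fun M : 'cV_N => M j 0) (mulKVmx Wunit (delta_mx m 0)).
  rewrite -/a !mxE andbT => <-; apply: eq_bigr => i _.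
  by rewrite mulrC !mxE.
under eq_bigr => i _ do rewrite (horner_coef_wide _ sp) mulr_sumr.
rewrite exchange_big /= (bigD1 m) //=.
under eq_bigr => i _ do rewrite mulrCA.
rewrite -mulr_sumr Wa eqxx mulr1 big1 ?addr0 // => j /negbTE jm.
by under eq_bigr => i _ do rewrite mulrCA; rewrite -mulr_sumr Wa jm mulr0.
Qed.

(** By interpolation, each coefficient is a linear combination of values at nonzero scalars. *)
Lemma poly_mx_coef_closed p q (P : 'M[k]_(p, q) -> Prop) (F : 'M[{poly k}]_(p, q)) :
  P 0 -> (forall c x y, P x -> P y -> P (c *: x + y)) ->
  (forall c, c != 0 -> P (map_mx (horner_eval c) F)) ->
  forall m, P (map_mx (coefp m) F).
Proof.
move=> P0 Plin PF m.
pose N := maxn m.+1 (\max_i \max_j size (F i j)).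
have ltmN : (m < N)%N by rewrite leq_max leqnn.
have sF i j : (size (F i j) <= N)%N.
  rewrite leq_max; apply/orP; right.
  exact: leq_trans (leq_bigmax j) (leq_bigmax (F := fun i => \max_j _) i).
have [a aP] := poly_coef_points (Ordinal ltmN).
have -> : map_mx (coefp m) F =
    \sum_i a i *: map_mx (horner_eval (i.+1%:R)) F.
  apply/matrixP => i j; rewrite summxE !mxE /coefp /= (aP _ (sF i j)).
  by apply: eq_bigr => l _; rewrite !mxE.
elim/big_rec: _ => // i x _ Px.
exact/Plin/Px/PF/char0_natS_neq0.
Qed.

Lemma poly_ext_neq0 (p q : {poly k}) :
  (forall c, c != 0 -> p.[c] = q.[c]) -> p = q.
Proof.
move=> e; apply/eqP; rewrite -subr_eq0; apply/eqP/polyP => m; rewrite coef0.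
pose F : 'M[{poly k}]_1 := (p - q)%:M.
suff: map_mx (coefp m) F = 0 by move/matrixP/(_ 0 0); rewrite !mxE eqxx.
apply: (@poly_mx_coef_closed 1 1 (eq^~ 0)) => //.
  by move=> c x y -> ->; rewrite scaler0 addr0.
move=> c c0; apply/matrixP => i j; rewrite !mxE !ord1 eqxx mulr1n.
by rewrite /horner_eval hornerD hornerN e // subrr.
Qed.

(* Reversing [q] turns the hypothesis into an equality of polynomials. *)
Lemma poly_inv_const (p q : {poly k}) :
  (forall c, c != 0 -> p.[c] = q.[c^-1]) -> (size p <= 1)%N.
Proof.
move=> e; pose N := size q.
pose r := \poly_(j < N.+1) q`_(N - j).
have er : p * 'X^N = r.
  apply: poly_ext_neq0 => c c0; rewrite hornerM hornerXn e //.
  rewrite (horner_coef_wide _ (leqnSn N)) horner_poly mulr_suml.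
  rewrite [RHS](reindex_inj rev_ord_inj) /=; apply: eq_bigr => j _.
  have lejN : (j <= N)%N by rewrite -ltnS.
  rewrite subSS subKn // exprVn -mulrA; congr (_ * _).
  have -> : c ^+ N = c ^+ (N - j) * c ^+ j by rewrite -exprD subnK.
  by rewrite mulrCA mulVf ?mulr1 ?expf_neq0.
have [->|p0] := eqVneq p 0; first by rewrite size_poly0.
have := size_poly N.+1 (fun j => q`_(N - j)).
by rewrite -/r -er size_mulXn // -add1n addnC leq_add2r.
Qed.

End CharZero.

(** * Evaluation of polynomials in algebras and extension of scalars *)

Section Evaluation.
Variables (k : fieldType) (R : comAlgType k).

(* [horner_alg] and [in_alg] with the instances needed to be recognized as
   morphisms of k-algebras. *)
Definition eval_at (u : R) : {poly k} -> R := horner_alg u.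
Fact eval_at_scalable u : scalable (eval_at u).
Proof. by move=> c p; rewrite /eval_at linearZ /= mulr_algl. Qed.
HB.instance Definition _ u := GRing.RMorphism.on (eval_at u).
HB.instance Definition _ u :=
  GRing.isScalable.Build k {poly k} R *:%R (eval_at u) (eval_at_scalable u).

Definition incl : k^o -> R := in_alg R.
Fact incl_scalable : scalable incl.
Proof. by move=> c p; rewrite /incl /= scalerA. Qed.
HB.instance Definition _ := GRing.RMorphism.copy incl (in_alg R).
HB.instance Definition _ :=
  GRing.isScalable.Build k k^o R *:%R incl incl_scalable.

Lemma eval_at_eq0 (u : R) (p : {poly k}) : (forall m, p`_m = 0) -> eval_at u p = 0.
Proof. 
move=> p0; have -> : p = 0 by apply/polyP => m; rewrite p0 coef0.
exact: rmorph0.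
Qed.

Lemma eval_atC (u : R) c : eval_at u c%:P = incl c.
Proof. exact: horner_algC. Qed.

Lemma eval_atX (u : R) : eval_at u 'X = u.
Proof. exact: horner_algX. Qed.

Lemma eval_at_sq0 (u : R) (p : {poly k}) : u * u = 0 -> eval_at u p = p`_0 *: 1 + p`_1 *: u.
Proof.
move=> uu; elim/poly_ind: p => [|p c _]; first by rewrite rmorph0 !coef0 !scale0r addr0.
elim/poly_ind: p => [|p d _].
  by rewrite mul0r add0r eval_atC !coefC scale0r addr0.
rewrite !rmorphD !rmorphM /= rmorphD rmorphM /= !eval_atX !eval_atC.
rewrite mulrDl -mulrA uu mulr0 add0r !(coefD, coefMX, coefC) /=.
by rewrite !add0r addr0 addrC mulr_algl.
Qed.
End Evaluation.

Lemma incl_scalar (k : fieldType) (c : k) : incl k^o c = c.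
Proof. exact: mulr1. Qed.

Lemma eval_at_scalar (k : fieldType) (c : k) (p : {poly k}) :
  eval_at (c : k^o) p = p.[c].
Proof.
elim/poly_ind: p => [|p d IH]; first by rewrite rmorph0 horner0.
rewrite rmorphD rmorphM /= eval_atX eval_atC IH !hornerE.
by congr (_ + _); exact: incl_scalar.
Qed.

Section Extension.
Variables (k : fieldType) (R : comAlgType k).

Definition ext p q (A : 'M[k]_(p, q)) : 'M[R]_(p, q) := map_mx (in_alg R) A.

Lemma ext0 p q : ext (0 : 'M_(p, q)) = 0.
Proof. exact: map_mx0. Qed.
Lemma ext1 p : ext (1%:M : 'M_p) = 1%:M.
Proof. exact: map_mx1. Qed.
Lemma extM p q r (A : 'M_(p, q)) (B : 'M_(q, r)) : ext (A *m B) = ext A *m ext B.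
Proof. exact: map_mxM. Qed.
Lemma extD p q (A B : 'M_(p, q)) : ext (A + B) = ext A + ext B.
Proof. exact: map_mxD. Qed.
Lemma extZ p q c (A : 'M_(p, q)) : ext (c *: A) = c%:A *: ext A.
Proof. exact: map_mxZ. Qed.
End Extension.
Arguments ext {k} R {p q} A.

(** * Subspaces after extension of scalars *)

Section InExt.
Variables (k : fieldType) (n : nat).
Implicit Types (U : {vspace 'cV[k]_n}) (R : comAlgType k).

(** With [B] the matrix of a projector onto [U], take [A = 1 - B]. Membership thus becomes one
    linear equation with coefficients in [k], the same for every [R]. *)
Lemma in_extP U : exists A : 'M[k]_n,
  (forall x, (x \in U) <-> (A *m x = 0)) /\
  (forall R (u : 'cV[R]_n), in_ext U u <-> ext R A *m u = 0).
Proof.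
pose B := \matrix_(i, j) (projv U (delta_mx j 0)) i 0 : 'M[k]_n.
have colB j : col j B = projv U (delta_mx j 0).
  by apply/matrixP => i l; rewrite !mxE !ord1.
have Bx x : B *m x = projv U x.
  rewrite {2}(matrix_sum_delta x) linear_sum /=; apply/matrixP => i j.
  rewrite mxE summxE; apply: eq_bigr => l _.
  by rewrite big_ord1 linearZ /= !mxE !ord1 mulrC.
exists (1%:M - B); split=> [x|R u].
  rewrite mulmxBl mul1mx Bx; split=> [xU|/subr0_eq ->]; last exact: memv_proj.
  by rewrite projv_id ?subrr.
split=> [[m [c [w [wU ->]]]]|/eqP].
  rewrite mulmx_sumr big1 // => i _.
  rewrite -scalemxAr -[vec_ext R (w i)]/(ext R (w i)) -extM mulmxBl mul1mx Bx.
  by rewrite projv_id ?wU // subrr ext0 scaler0.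
rewrite /ext map_mxB map_mx1 mulmxBl mul1mx subr_eq0 => /eqP uB.
exists n, (fun j => u j 0), (fun j => col j B); split.
  by move=> j; rewrite colB memv_proj.
rewrite {1}uB; apply/matrixP => i j; rewrite mxE summxE.
by apply: eq_bigr => l _; rewrite !mxE !ord1 mulrC.
Qed.

Lemma in_ext_lin U R (c : R) (x y : 'cV[R]_n) :
  in_ext U x -> in_ext U y -> in_ext U (c *: x + y).
Proof.
have [A [_ AP]] := in_extP U; move=> /AP Ax /AP Ay; apply/AP.
by rewrite mulmxDr -scalemxAr Ax Ay scaler0 addr0.
Qed.

Lemma in_ext0 U R : in_ext U (0 : 'cV[R]_n).
Proof. by have [A [_ AP]] := in_extP U; apply/AP; rewrite mulmx0. Qed.

Lemma in_ext_sum U R m (F : 'I_m -> 'cV[R]_n) :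
  (forall i, in_ext U (F i)) -> in_ext U (\sum_i F i).
Proof.
move=> UF; elim/big_rec: _ => [|i x _ Ux]; first exact: in_ext0.
by rewrite -[F i]scale1r; apply: in_ext_lin.
Qed.

Lemma in_ext_mem U R x : x \in U -> in_ext U (vec_ext R x).
Proof.
by move=> xU; exists 1, (fun=> 1), (fun=> x); rewrite big_ord1 scale1r.
Qed.

Lemma mem_in_ext U (x : 'cV[k]_n) : in_ext U (vec_ext k^o x) -> x \in U.
Proof.
have [A [AP AP']] := in_extP U; move=> /AP' Ax; apply/AP.
rewrite -[RHS]Ax -[vec_ext _ _]/(ext k^o x) -extM; apply/matrixP => i j.
by rewrite [RHS]mxE; apply/esym; exact: incl_scalar.
Qed.

Lemma stable_in_ext U R (M : 'M[R]_n) :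
  (forall x, x \in U -> in_ext U (M *m vec_ext R x)) ->
  forall u, in_ext U u -> in_ext U (M *m u).
Proof.
move=> MU _ [m [c [w [wU ->]]]]; rewrite mulmx_sumr; apply: in_ext_sum => i.
rewrite -scalemxAr -[_ *: _]addr0; apply: in_ext_lin; last exact: in_ext0.
exact: MU.
Qed.

(** The span of an arbitrary family: vectors of [Q] are adjoined until none lies outside. The second
    clause is the induction principle of the span. *)
Lemma span_exists (Q : 'cV[k]_n -> Prop) : exists U : {vspace 'cV[k]_n},
  (forall x, Q x -> x \in U) /\
  (forall P : 'cV[k]_n -> Prop, P 0 ->
     (forall c x y, P x -> P y -> P (c *: x + y)) -> (forall x, Q x -> P x) ->
     forall x, x \in U -> P x).
Proof.
pose below (W : {vspace 'cV[k]_n}) := forall P : 'cV[k]_n -> Prop, P 0 ->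
  (forall c x y, P x -> P y -> P (c *: x + y)) -> (forall x, Q x -> P x) ->
  forall x, x \in W -> P x.
(* [m] bounds the codimension still available; each adjoined vector uses up one unit. *)
suff grow m (W : {vspace 'cV[k]_n}) : (n <= \dim W + m)%N -> below W ->
    exists U : {vspace 'cV[k]_n}, (forall x, Q x -> x \in U) /\ below U.
  apply: (grow n 0%VS) => [|P P0 _ _ x]; first exact: leq_addl.
  by rewrite memv0 => /eqP ->; exact: P0.
elim: m W => [|m IH] W dimW Wle.
  exists W; split=> // x _; suff -> : W = fullv by rewrite memvf.
  apply/eqP; rewrite eqEdim subvf dimvf /dim /= muln1.
  by rewrite addn0 in dimW.
have [[x [Qx xW]]|allW] := classic (exists x, Q x /\ x \notin W); last first.
  exists W; split=> // x Qx; apply/negPn/negP => xW; apply: allW.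
  by exists x.
apply: (IH (W + <[x]>)%VS) => [|P P0 Plin QP y].
  rewrite (leq_trans dimW) // addnS -addSn leq_add2r ltnNge.
  apply: contra xW => le; have /eqP -> : W == (W + <[x]>)%VS by rewrite eqEdim addvSl.
  exact: subvP (addvSr _ _) _ (memv_line x).
move=> /memv_addP[z zW [_ /vlineP[c ->] ->]]; rewrite addrC.
by apply: (Plin); [exact: QP | exact: Wle P P0 Plin QP z zW].
Qed.
End InExt.

(** * Representations and stabilizers of subspaces *)

Section GroupHom.
Variables (k : fieldType) (G : group_functor k).

Lemma gmul_idem R (g : G R) : gmul g g = g -> g = gone G R.
Proof.
by move=> e; rewrite -[LHS]gmul1 -[in LHS](gmulV g) -gmulA e gmulV.
Qed.

Lemma hom_one (H : group_functor k) (f : group_hom H G) R :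
  f R (gone H R) = gone G R.
Proof. by apply: gmul_idem; rewrite -hom_mul gmul1. Qed.
End GroupHom.

Section RepInverse.
Variables (k : fieldType) (G : group_functor k) (n : nat) (V : representation G n).

Lemma repVl R (g : G R) : V R (ginv g) *m V R g = 1%:M.
Proof. by rewrite -repM gmulV rep1. Qed.

Lemma repVr R (g : G R) : V R g *m V R (ginv g) = 1%:M.
Proof. exact/mulmx1C/repVl. Qed.

Lemma repV_eq R (g : G R) M : M *m V R g = 1%:M -> V R (ginv g) = M.
Proof. by move=> Mg; rewrite -[RHS]mulmx1 -(repVr g) mulmxA Mg mul1mx. Qed.

Lemma repV_nat (R S : comAlgType k) (f : {lrmorphism R -> S}) (g : G R) :
  V S (ginv (gmap f g)) = map_mx f (V R (ginv g)).
Proof. by apply: repV_eq; rewrite rep_nat -map_mxM repVl map_mx1. Qed.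
End RepInverse.

Section Stabilizer.
Variables (k : fieldType) (G : alg_group k) (n : nat) (V : representation G n).
Variable U : {vspace 'cV[k]_n}.

(** The condition on the inverse is built in, which makes closure under inversion immediate. *)
Definition stab : subfunctor G := fun R g =>
  (forall u, in_ext U u -> in_ext U (V R g *m u)) /\
  (forall u, in_ext U u -> in_ext U (V R (ginv g) *m u)).

(** With [A] from [in_extP], the coordinates of [A] applied to the translates of vectors of [U] by
    the universal point and by its inverse are functions on the group. Their common zeros form the
    stabilizer. *)
Lemma stab_closed : closed_subgroup stab.
Proof.
split.
- move=> R.
  by rewrite /stab (@repV_eq _ _ _ V _ _ 1%:M) ?mul1mx ?rep1 //;
    split=> u; rewrite mul1mx.
- move=> R x y [Ux Ux'] [Uy Uy'].
  rewrite /stab (@repV_eq _ _ _ V _ _ (V R (ginv y) *m V R (ginv x))); last first.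
    by rewrite repM mulmxA -(mulmxA _ _ (V R x)) repVl mulmx1 repVl.
  by split=> u Uu; rewrite ?repM -mulmxA; auto.
- move=> R x [Ux Ux']; split=> //.
  by rewrite (@repV_eq _ _ _ V _ _ (V R x)) // repVr.
have [A [_ AP]] := in_extP U.
pose entries (M : 'M[coord G]_n) a := exists x i,
  x \in U /\ a = (ext _ A *m (M *m vec_ext _ x)) i 0.
have entriesP (R : comAlgType k) (f : {lrmorphism coord G -> R}) M :
    (forall u, in_ext U u -> in_ext U (map_mx f M *m u)) <->
    (forall a, entries M a -> f a = 0).
  have fext p q (B : 'M[k]_(p, q)) : map_mx f (ext _ B) = ext R B.
    by apply/matrixP => i j; rewrite !mxE /= linearZ /= rmorph1.
  have fE x i : f ((ext _ A *m (M *m vec_ext _ x)) i 0) =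
      (ext R A *m (map_mx f M *m vec_ext R x)) i 0.
    rewrite -[vec_ext R x]/(ext R x) -[ext R x]fext -map_mxM -[ext R A]fext -map_mxM.
    by rewrite [RHS]mxE.
  split=> [UM a [x [i [xU ->]]]|Ma].
    have /AP e := UM _ (in_ext_mem R xU).
    by rewrite fE e mxE.
  apply: stable_in_ext => x xU; apply/AP; apply/matrixP => i j.
  by rewrite (ord1 j) -fE Ma; [rewrite mxE | exists x, i].
exists (fun a => entries (V _ (univ G)) a \/ entries (V _ (ginv (univ G))) a).
move=> R f; rewrite /stab repV_nat rep_nat; split=> [[/entriesP e1 /entriesP e2]|e].
  by move=> a [/e1|/e2].
by split; apply/entriesP => a ea; apply: e; [left | right].
Qed.

Lemma generated_stabilizes (S : subfunctor G) :
  (forall R (g : G R), S R g -> stab g) ->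
  forall R (g : G R), generated S g -> stab g.
Proof. by move=> Sst R g; apply; [exact: stab_closed | exact: Sst]. Qed.

End Stabilizer.

(** * One-parameter subgroups and their derivatives *)

Section OneParameter.
Variables (k : fieldType) (char0 : [pchar k] =i pred0).
Variables (G : group_functor k) (n : nat) (V : representation G n).
Variable x : group_hom (Ga k) G.

(** The universal point ['X] acts by a polynomial matrix of which the action of every point is a
    specialization; [dact] is its derivative at 0. *)
Definition pmx : 'M[{poly k}]_n := V {poly k} (x {poly k} 'X).
Definition dact : 'M[k]_n := map_mx (coefp 1) pmx.

Lemma one_paramE (R : comAlgType k) (u : R) :
  V R (x R u) = map_mx (eval_at u) pmx.
Proof.
rewrite -[map_mx _ _](@rep_nat _ _ _ V {poly k} R (eval_at u)) -hom_nat.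
by rewrite /= eval_atX.
Qed.

Lemma one_param_k (c : k) : V k^o (x k^o c) = map_mx (horner_eval c) pmx.
Proof.
by rewrite one_paramE; apply/matrixP => i j; rewrite !mxE eval_at_scalar.
Qed.

Lemma one_param_incl (R : comAlgType k) (c : k) :
  V R (x R c%:A) = ext R (map_mx (horner_eval c) pmx).
Proof.
rewrite -one_param_k -[ext R _](@rep_nat _ _ _ V k^o R (incl R)) -hom_nat.
by [].
Qed.

Lemma pmx_coef0 : map_mx (coefp 0) pmx = 1%:M.
Proof.
rewrite -(rep1 V k^o) -(hom_one x) one_param_k.
by apply/matrixP => i j; rewrite !mxE /horner_eval horner_coef0.
Qed.

(** Differentiating [P(X + c) = P(X) P(c)] at [X = 0] gives [P'(c) = P'(0) P(c)]. *)
Lemma pmx_deriv : map_mx deriv pmx = map_mx polyC dact *m pmx.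
Proof.
apply/matrixP => i j; apply: (poly_ext_neq0 char0) => c _; rewrite !mxE.
have : pmx i j \Po ('X + c%:P) = \sum_l pmx i l * (pmx l j).[c]%:P.
  have := congr1 (fun M : 'M_n => M i j)
    (repM V (x {poly k} 'X) (x {poly k} (c%:A : {poly k}))).
  rewrite -hom_mul one_paramE one_param_incl !mxE => e.
  have -> : pmx i j \Po ('X + c%:P) = eval_at ('X + c%:A : {poly k}) (pmx i j).
    rewrite -alg_polyC; elim/poly_ind: (pmx i j) => [|p d IH].
      by rewrite !rmorph0.
    by rewrite comp_poly_MXaddC IH [RHS]rmorphD [in RHS]rmorphM /= eval_atX eval_atC /incl /= !alg_polyC.
  rewrite e; apply: eq_bigr => l _.
  by rewrite !mxE /= alg_polyC.
move/(congr1 (fun p => p^`().[0])); rewrite deriv_comp derivD derivX derivC addr0 mulr1.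
rewrite horner_comp !hornerE => ->.
rewrite (raddf_sum (deriv : {additive {poly k} -> {poly k}})) !horner_sum.
apply: eq_bigr => l _; rewrite /= derivM derivC mulr0 addr0 !mxE !hornerM !hornerC.
by rewrite horner_coef0 coef_deriv mulr1n.
Qed.

(** The differential equation read on coefficients. In characteristic zero it says that [pmx] is the
    exponential of [X] times [dact]. *)
Lemma pmx_coefS m :
  m.+1%:R *: map_mx (coefp m.+1) pmx = dact *m map_mx (coefp m) pmx.
Proof.
apply/matrixP => i j.
have := congr1 (fun M : 'M[{poly k}]_n => (M i j)`_m) pmx_deriv.
rewrite !mxE coef_deriv /coefp mulr_natl => ->; rewrite coef_sum.
by apply: eq_bigr => l _; rewrite !mxE coefCM.
Qed.

(** The coefficient of degree [m] is the [m]-th power of [dact] divided by [m!]. *)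
Lemma pmx_coef_closed p (P : 'M[k]_(n, p) -> Prop) y :
  P y -> (forall z, P z -> P (dact *m z)) -> (forall c z, P z -> P (c *: z)) ->
  forall m, P (map_mx (coefp m) pmx *m y).
Proof.
move=> Py Pd PZ; elim=> [|m IH]; first by rewrite pmx_coef0 mul1mx.
rewrite -[map_mx _ _]scale1r -(mulVf (char0_natS_neq0 char0 m)) -scalerA pmx_coefS.
by rewrite -scalemxAl -mulmxA; apply/PZ/Pd.
Qed.

Lemma one_param_vec (R : comAlgType k) (u : R) p (y : 'M_(n, p)) :
  V R (x R u) *m ext R y = map_mx (eval_at u) (pmx *m map_mx polyC y).
Proof.
rewrite map_mxM one_paramE; congr (_ *m _).
by apply/matrixP => i j; rewrite !mxE; exact/esym/eval_atC.
Qed.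

Lemma coef_pmx_vec p m (y : 'M_(n, p)) :
  map_mx (coefp m) (pmx *m map_mx polyC y) = map_mx (coefp m) pmx *m y.
Proof.
apply/matrixP => i j; rewrite !mxE /coefp coef_sum.
by apply: eq_bigr => l _; rewrite !mxE coefMC.
Qed.

Lemma one_param_triv p (y : 'M_(n, p)) (R : comAlgType k) (u : R) :
  dact *m y = 0 -> V R (x R u) *m ext R y = ext R y.
Proof.
move=> y0; rewrite one_param_vec.
have ym m : map_mx (coefp m.+1) pmx *m y = 0.
  elim: m => [|m IH]; first exact: y0.
  rewrite -[map_mx _ _]scale1r -(mulVf (char0_natS_neq0 char0 m.+1)) -scalerA pmx_coefS.
  by rewrite -scalemxAl -mulmxA IH mulmx0 scaler0.
suff -> : pmx *m map_mx polyC y = map_mx polyC y.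
  by apply/matrixP => i j; rewrite !mxE eval_atC.
apply/matrixP => i j; apply/polyP => m.
have := coef_pmx_vec m y; move/matrixP/(_ i j); rewrite [LHS]mxE /coefp => ->.
case: m => [|m]; first by rewrite pmx_coef0 mul1mx mxE coefC.
by rewrite ym !mxE coefC.
Qed.

(** A subspace invariant under [dact] is invariant under all coefficients of [pmx], hence under
    every point, over every [R]. *)
Lemma one_param_stable (U : {vspace 'cV[k]_n}) (R : comAlgType k) (u : R) :
  (forall y, y \in U -> dact *m y \in U) ->
  forall w, in_ext U w -> in_ext U (V R (x R u) *m w).
Proof.
move=> dU; have [A [AP AP']] := in_extP U; apply: stable_in_ext => y yU.
rewrite -[vec_ext R y]/(ext R y) one_param_vec; apply/AP'.
rewrite [ext R A](_ : _ = map_mx (eval_at u) (map_mx polyC A)); last first.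
  by apply/matrixP => i j; rewrite !mxE eval_atC.
rewrite -map_mxM; apply/matrixP => i j; rewrite !mxE; apply: eval_at_eq0 => m.
have : map_mx (coefp m) pmx *m y \in U.
  by apply: (pmx_coef_closed (P := fun z => z \in U)) => // c z zU; apply: memvZ.
move/AP; rewrite -coef_pmx_vec => /matrixP/(_ i j); rewrite [RHS]mxE => e.
rewrite -[RHS]e [RHS]mxE coef_sum; apply: eq_bigr => l _.
by rewrite [map_mx polyC A _ _]mxE coefCM [map_mx (coefp m) _ _ _]mxE.
Qed.

(* Testing on scalars is enough since k is infinite. *)
Lemma dact_closed (R : comAlgType k) p (P : 'M[R]_(n, p) -> Prop) (y : 'M_(n, p)) :
  P 0 -> (forall c z z', P z -> P z' -> P (c *: z + z')) ->
  (forall c : k, c != 0 -> P (V R (x R c%:A) *m ext R y)) ->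
  P (ext R (dact *m y)).
Proof.
move=> P0 Plin Px.
pose F := pmx *m map_mx polyC y.
have -> : dact *m y = map_mx (coefp 1) F.
  by rewrite coef_pmx_vec.
apply: (poly_mx_coef_closed char0 (P := fun z => P (ext R z))).
- by rewrite ext0.
- by move=> c z z' Pz Pz'; rewrite extD extZ; apply: Plin.
move=> c c0; rewrite map_mxM extM -one_param_incl.
rewrite (_ : map_mx _ (map_mx _ y) = y); first exact: Px.
by apply/matrixP => i j; rewrite !mxE; exact: hornerC.
Qed.

End OneParameter.

Lemma eval_at_wide (k : fieldType) (R : comAlgType k) N (u : R) (p : {poly k}) :
  (size p <= N)%N -> eval_at u p = \sum_(j < N) p`_j *: u ^+ j.
Proof.
move=> sp; rewrite -{1}(coefK p) poly_def.
rewrite (big_ord_widen _ (fun j => p`_j *: 'X^j) sp).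
rewrite linear_sum /= big_mkcond; apply: eq_bigr => j _.
case: ltnP => [_|le]; last by rewrite (nth_default _ le) scale0r.
by rewrite linearZ rmorphXn /= eval_atX.
Qed.

(** Interpolation isolates the linear coefficient, with weights and nodes that serve all [R] and [s]
    at once. This carries conjugation formulas over from points to [dact]. *)
Lemma dact_points (k : fieldType) (char0 : [pchar k] =i pred0)
    (G : group_functor k) n (V : representation G n) (x : group_hom (Ga k) G) :
  exists N (a p : 'I_N -> k), forall (R : comAlgType k) (s : R),
    s *: ext R (dact V x) = \sum_i (a i)%:A *: V R (x R (s * (p i)%:A)).
Proof.
(* The [.+2] guarantees that index 1 exists, whatever the sizes of the entries. *)
pose N := (\max_i \max_j size (pmx V x i j)).+2.
have sF i j : (size (pmx V x i j) <= N)%N.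
  apply/leqW/leqW.
  exact: leq_trans (leq_bigmax j) (leq_bigmax (F := fun i => \max_j _) i).
have [a aP] := poly_coef_points char0 (Ordinal (isT : (1 < N)%N)).
exists N, a, (fun i => i.+1%:R) => R s.
have aX j : (j < N)%N -> \sum_i a i * i.+1%:R ^+ j = (j == 1)%:R.
  move=> ltj; have := aP 'X^j; rewrite size_polyXn coefXn eq_sym => -> //.
  by apply: eq_bigr => i _; rewrite hornerXn.
apply/matrixP => i j; rewrite summxE !mxE.
have term (b c d : k) m :
    b%:A * (c *: (s * d%:A) ^+ m) = (c * (b * d ^+ m)) *: s ^+ m.
  rewrite mulr_algl exprMn -(rmorphXn (in_alg R)) /= mulr_algr !scalerA.
  by congr (_ *: _); rewrite mulrCA mulrA.
under [RHS]eq_bigr => l _.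
  rewrite !mxE one_paramE mxE (eval_at_wide _ (sF i j)) mulr_sumr.
  under eq_bigr => m _ do rewrite term.
  over.
rewrite exchange_big /= (bigD1 (Ordinal (isT : (1 < N)%N))) //=.
rewrite -scaler_suml -mulr_sumr aX // mulr1 big1 ?addr0; last first.
  move=> m; rewrite -val_eqE /= => /negbTE m1.
  by rewrite -scaler_suml -mulr_sumr aX // m1 mulr0 scale0r.
by rewrite mulr_algr.
Qed.

(** * Square-zero parameters and dual numbers *)

Section SquareZero.
Variables (k : fieldType) (R : comAlgType k) (e : R) (n : nat).
Hypotheses (ee : e * e = 0) (e_neq0 : e != 0).
Implicit Types A B M S P Q : 'M[k]_n.

Lemma sqz_mul A B :
  (1%:M + e *: ext R A) *m (1%:M + e *: ext R B) = 1%:M + e *: ext R (A + B).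
Proof.
rewrite mulmxDl mul1mx mulmxDr mulmx1 -scalemxAl -scalemxAr scalerA ee scale0r.
by rewrite addr0 extD scalerDr -addrA [_ *: ext R B + _]addrC.
Qed.

Lemma sqz_div (X : 'M[R]_n) M S :
  X *m (1%:M + e *: ext R S) = 1%:M + e *: ext R M ->
  X = 1%:M + e *: ext R (M - S).
Proof.
move=> /(congr1 (mulmx^~ (1%:M + e *: ext R (- S)))).
by rewrite -mulmxA !sqz_mul subrr ext0 scaler0 addr0 mulmx1.
Qed.

Lemma sqz_conj P Q A : P *m Q = 1%:M ->
  ext R P *m (1%:M + e *: ext R A) *m ext R Q = 1%:M + e *: ext R (P *m A *m Q).
Proof.
move=> PQ; rewrite mulmxDr mulmxDl mulmx1 -extM PQ ext1.
by rewrite -scalemxAr -scalemxAl -!extM.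
Qed.

(** Coefficients of [e] can be compared: [e] is a nonzero vector of [R] and the matrices have
    entries in [k]. *)
Lemma sqz_comm P A :
  ext R P *m (1%:M + e *: ext R A) = (1%:M + e *: ext R A) *m ext R P ->
  P *m A = A *m P.
Proof.
rewrite mulmxDr mulmxDl mulmx1 mul1mx -scalemxAr -scalemxAl -!extM => /addrI eq_e.
apply/matrixP => i j; apply/eqP; rewrite -subr_eq0.
have := congr1 (fun N : 'M_n => N i j) eq_e.
rewrite mxE [RHS]mxE [ext _ _ _ _]mxE [X in _ = _ * X]mxE !mulr_algr => /eqP.
by rewrite -subr_eq0 -scalerBl scaler_eq0 (negbTE e_neq0) orbF.
Qed.
End SquareZero.

Section DualNumbers.
Variable k : fieldType.

Lemma eps_neq0 : eps k != 0.
Proof.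
apply/eqP => /(congr1 (fun z : {poly %/ 'X^2} => (z : {poly k})`_1)).
rewrite /eps /qpolyX /= mk_monic_Xn Pdiv.CommonRing.rmodp_small ?size_polyX ?size_polyXn //.
by rewrite coefX coef0 => /eqP; rewrite oner_eq0.
Qed.

Lemma dact_eps (char0 : [pchar k] =i pred0) (G : group_functor k) n
    (V : representation G n) (x : group_hom (Ga k) G) (c : k) :
  V (dual_numbers k) (x (dual_numbers k) (c *: eps k)) =
  1%:M + eps k *: ext _ (c *: dact V x).
Proof.
rewrite one_paramE; apply/matrixP => i j; rewrite !mxE eval_at_sq0; last first.
  by rewrite -scalerAl -scalerAr eps2 !scaler0.
have := pmx_coef0 V x; move/matrixP/(_ i j); rewrite !mxE /coefp => ->.
by rewrite mulr_algr scalerA mulrC; congr (_ + _); case: (i == j); rewrite ?scale1r ?scale0r.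
Qed.

End DualNumbers.

(** Induction on the sum: conjugating by [t] and subtracting [chi i t *: X] removes [y i] and
    multiplies [X] by the nonzero scalar [chi0 t - chi i t]. *)
Lemma eigen_independent (k : fieldType) n (T I : Type) (A B : T -> 'M[k]_n)
    (s : seq I) (y : I -> 'M[k]_n) (chi : I -> T -> k) X (chi0 : T -> k) :
  (forall t, A t *m X *m B t = chi0 t *: X) ->
  (forall i t, A t *m y i *m B t = chi i t *: y i) ->
  (forall i, y i = 0 \/ exists t, chi i t != chi0 t) ->
  X = \sum_(i <- s) y i -> X = 0.
Proof.
move=> AX Ay y_chi; elim: s X y AX Ay y_chi => [|i s IH] X y AX Ay y_chi.
  by rewrite big_nil.
rewrite big_cons => eX.
have [y0|[t tchi]] := y_chi i; first by apply: (IH X y) => //; rewrite eX y0 add0r.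
have ct : chi0 t - chi i t != 0 by rewrite subr_eq0 eq_sym.
apply/eqP; rewrite -[_ == _]orFb -(negbTE ct) -scaler_eq0; apply/eqP.
apply: (IH _ (fun j => (chi j t - chi i t) *: y j)).
- by move=> u; rewrite -scalemxAr -scalemxAl AX !scalerA mulrC.
- by move=> j u; rewrite -scalemxAr -scalemxAl Ay !scalerA mulrC.
- by move=> j; have [->|?] := y_chi j; [left; rewrite scaler0 | right].
rewrite scalerBl -AX eX !mulmxDr !mulmxDl Ay scalerDr opprD addrACA subrr add0r.
rewrite mulmx_sumr mulmx_suml scaler_sumr -sumrB; apply: eq_bigr => j _.
by rewrite Ay scalerBl.
Qed.

Lemma coefp1_mul (k : fieldType) p q r (A : 'M[{poly k}]_(p, q)) (B : 'M_(q, r)) :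
  map_mx (coefp 1) (A *m B) =
  map_mx (coefp 1) A *m map_mx (coefp 0) B + map_mx (coefp 0) A *m map_mx (coefp 1) B.
Proof.
apply/matrixP => i j; rewrite !mxE /coefp coef_sum -big_split /=.
apply: eq_bigr => l _; rewrite !mxE coefM !big_ord_recl big_ord0 addr0 /=.
by rewrite addrC.
Qed.

Lemma zpow_expz (k : fieldType) (u v : k) z :
  u * v = 1 -> zpow (u : k^o) v z = u ^ z.
Proof.
move=> uv; have u0 : u != 0.
  by apply: contra_eq_neq uv => ->; rewrite mul0r eq_sym oner_eq0.
have -> : v = u^-1 by apply: (mulfI u0); rewrite uv mulfV.
case: z => m /=; first by rewrite -exprnP.
by rewrite NegzE -exprnN exprVn.
Qed.

(** * Characters of the torus *)

Section Torus.
Variables (k : fieldType) (r : nat).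

Lemma character_expz (x : 'rV[int]_r) (t : torus k r k^o) :
  character x t = \prod_i (tval t i : k) ^ (x 0 i).
Proof. by apply: eq_bigr => i _; exact: zpow_expz (tvalV t i). Qed.

Lemma tval_neq0 (t : torus k r k^o) i : (tval t i : k) != 0.
Proof.
by apply: contra_eq_neq (tvalV t i) => ->; rewrite mul0r eq_sym oner_eq0.
Qed.

Lemma characterD (x y : 'rV[int]_r) (t : torus k r k^o) :
  character (x + y) t = (character x t : k) * character y t.
Proof.
rewrite !character_expz -big_split /=; apply: eq_bigr => i _.
by rewrite mxE expfzDr ?tval_neq0.
Qed.

Lemma torus_mulC (R : comAlgType k) (s t : torus k r R) : gmul s t = gmul t s.
Proof. by apply: torus_eq => i; rewrite !tval_mk mulrC. Qed.

Hypothesis char0 : [pchar k] =i pred0.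

Definition two_pt_val (i j : 'I_r) : k := if j == i then 2%:R else 1.

Lemma two_pt_subproof i j : (two_pt_val i j : k^o) * (two_pt_val i j)^-1 = 1.
Proof. by rewrite mulfV // /two_pt_val; case: ifP => _; rewrite ?oner_eq0 ?char0_natS_neq0. Qed.

Definition two_pt i : torus k r k^o := torus_mk (two_pt_subproof i).

Lemma character_two_pt x i : character x (two_pt i) = (2%:R : k) ^ (x 0 i).
Proof.
rewrite character_expz (bigD1 i) //= big1 => [|j /negbTE ji].
  by rewrite mulr1 tval_mk /two_pt_val eqxx.
by rewrite tval_mk /two_pt_val ji exp1rz.
Qed.

(** A point with 2 in a coordinate where [x] and [y] differ, and 1 elsewhere, tells them apart. *)
Lemma character_sep (x y : 'rV[int]_r) : x != y ->
  exists t : torus k r k^o, character x t != character y t.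
Proof.
rewrite -subr_eq0 => /rV0Pn [i xy].
exists (two_pt i); rewrite !character_two_pt; apply: contra xy => /eqP e.
rewrite mxE [(- y) _ _]mxE; apply/eqP/(expz2_inj char0).
by rewrite expfzDr ?(char0_natS_neq0 char0 1) // e -expfzDr ?(char0_natS_neq0 char0 1) // subrr.
Qed.

End Torus.

Lemma ext_scalar (k : fieldType) p q (A : 'M[k]_(p, q)) : ext k^o A = A.
Proof. by apply/matrixP => i j; rewrite mxE; exact: incl_scalar. Qed.

Lemma lrmorph_eps (k : fieldType) (p : {lrmorphism dual_numbers k -> k^o}) : p (eps k) = 0.
Proof.
have : p (eps k) * p (eps k) = 0 by rewrite -rmorphM eps2 rmorph0.
by move=> /eqP; rewrite mulf_eq0 orbb => /eqP.
Qed.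

Section ScalarPoints.
Variables (k : fieldType) (G : group_functor k) (n : nat) (V : representation G n).

(* The ring structures of k^o and k are convertible but not syntactically equal;
   [krep] takes values in matrices over k. *)
Definition krep (g : G k^o) : 'M[k]_n := V k^o g.

Lemma krepM g h : krep (gmul g h) = krep g *m krep h.
Proof. exact (repM V g h). Qed.
Lemma krep1 : krep (gone G k^o) = 1%:M.
Proof. exact (rep1 V k^o). Qed.
Lemma krepVl g : krep (ginv g) *m krep g = 1%:M.
Proof. exact (repVl V g). Qed.
Lemma krepVr g : krep g *m krep (ginv g) = 1%:M.
Proof. exact (repVr V g). Qed.
Lemma rep_incl R (g : G k^o) : V R (gmap (incl R) g) = ext R (krep g).
Proof. exact (rep_nat V (incl R) g). Qed.
Lemma krep_vec g y : V k^o g *m vec_ext k^o y = krep g *m y.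
Proof. by rewrite -[vec_ext _ _]/(ext k^o y) ext_scalar. Qed.
Lemma krep_one_param (x : group_hom (Ga k) G) (c : k) :
  krep (x k^o c) = map_mx (horner_eval c) (pmx V x).
Proof. exact: one_param_k. Qed.
End ScalarPoints.

(** * Root operators and their brackets *)

Section RootOperators.
Variables (k : fieldType) (char0 : [pchar k] =i pred0).
Variables (D : root_datum) (G : split_group k D) (n : nat) (V : representation G n).

Definition rop (a : 'rV[int]_(rk D)) : 'M[k]_n := dact V (xroot G a).

Lemma torus_rop a R (t : torus k (rk D) R) : a \in roots D ->
  V R (maxtorus G R t) *m ext R (rop a) =
  character a t *: (ext R (rop a) *m V R (maxtorus G R t)).
Proof.
move=> aD; have [N [c [p cp]]] := dact_points char0 V (xroot G a).
(* The interpolation formula is used with [s = character a t] on the right and [s = 1] on the left.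
   Nodes and weights agree, so the sums match termwise through [xroot_conj]. *)
rewrite /rop scalemxAl cp -[ext R _]scale1r cp mulmx_sumr mulmx_suml.
apply: eq_bigr => i _; rewrite -scalemxAr -scalemxAl mul1r; congr (_ *: _).
rewrite -xroot_conj // !repM -!mulmxA repVl mulmx1 //.
Qed.

Lemma torus_rop_conj a (t : torus k (rk D) k^o) : a \in roots D ->
  krep V (maxtorus G _ t) *m rop a *m krep V (ginv (maxtorus G _ t)) =
  character a t *: rop a.
Proof.
move=> aD; have : krep V (maxtorus G _ t) *m rop a =
    character a t *: (rop a *m krep V (maxtorus G _ t)).
  by have := torus_rop t aD; rewrite ext_scalar.
by move=> ->; rewrite -scalemxAl -mulmxA krepVr mulmx1.
Qed.

Lemma rep_Lie_elt (s : seq 'rV[int]_(rk D)) c :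
  V _ (foldr (fun a g => gmul (xroot G a (dual_numbers k) (c a *: eps k)) g)
       (gone G _) s) =
  1%:M + eps k *: ext _ (\sum_(a <- s) c a *: rop a).
Proof.
elim: s => [|a s IH] /=; first by rewrite rep1 big_nil ext0 scaler0 addr0.
rewrite repM IH big_cons (dact_eps char0); exact: (sqz_mul (eps2 k)).
Qed.

(** A linear space of operators containing the image of Lie(G); of the contribution of Lie(T) it
    records only that it commutes with the torus. *)
Definition Lie_op (M : 'M[k]_n) := exists B c,
  (forall t : torus k (rk D) k^o,
     krep V (maxtorus G _ t) *m B = B *m krep V (maxtorus G _ t)) /\
  M = B + \sum_(a <- roots D) c a *: rop a.

(** Dividing the action of [g] by its root part leaves the action of a point of the torus, and the
    torus is commutative. *)
Lemma Lie_opE (g : G (dual_numbers k)) M :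
  in_Lie g -> V _ g = 1%:M + eps k *: ext _ M -> Lie_op M.
Proof.
move=> /sgroup_Lie [h [c ->]]; rewrite /Lie_elt repM rep_Lie_elt.
move=> /(sqz_div (eps2 k)) eX.
exists (M - \sum_(a <- roots D) c a *: rop a), c; split; last by rewrite subrK.
move=> t; apply: (sqz_comm (eps_neq0 k)); rewrite -eX -!rep_incl.
by rewrite -hom_nat -!repM -!hom_mul torus_mulC.
Qed.

Lemma Lie_op_lin c M N : Lie_op M -> Lie_op N -> Lie_op (c *: M + N).
Proof.
move=> [B [x [tB ->]]] [B' [x' [tB' ->]]].
exists (c *: B + B'), (fun a => c * x a + x' a); split.
  by move=> t; rewrite mulmxDl mulmxDr -scalemxAl -scalemxAr tB tB'.
rewrite scalerDr addrACA; congr (_ + _).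
rewrite scaler_sumr -big_split; apply: eq_bigr => a _ /=.
by rewrite scalerDl scalerA.
Qed.

Lemma Lie_op0 : Lie_op 0.
Proof.
exists 0, (fun=> 0); split=> [t|]; first by rewrite mulmx0 mul0mx.
by rewrite add0r big1 // => a _; rewrite scale0r.
Qed.

(** The adjoint action of [x_a(c)] on the root vector of [b]: the conjugate of [x_b(eps)] by
    [x_a(c)] becomes trivial when [eps] is sent to 0. *)
Lemma Lie_op_conj a b (c : k) :
  Lie_op (map_mx (horner_eval c) (pmx V (xroot G a)) *m rop b *m
          map_mx (horner_eval (- c)) (pmx V (xroot G a))).
Proof.
have xx R : gmul (xroot G a R c%:A) (xroot G a R (- c)%:A) = gone G R.
  by rewrite -hom_mul /= -scalerDl subrr scale0r; exact: (hom_one (xroot G a)).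
apply: (@Lie_opE (gmul (gmul (xroot G a _ c%:A) (xroot G b _ (1 *: eps k)))
                       (xroot G a _ (- c)%:A))).
  move=> p; rewrite !gmap_mul -[gmap p (xroot G b _ _)]hom_nat.
  rewrite [gmap p (_ : Ga k _)]/= scale1r lrmorph_eps.
  rewrite (hom_one (xroot G b) k^o) -!hom_nat /= !linearZ !rmorph1.
  by rewrite -gmulA gmul1; exact: xx.
rewrite !repM !one_param_incl (dact_eps char0) scale1r.
apply: sqz_conj; rewrite -!krep_one_param -krepM -hom_mul /= subrr.
by rewrite (hom_one (xroot G a) k^o) krep1.
Qed.

(** The bracket is the linear coefficient of [x_a(X) E_b x_a(-X)], whose values satisfy [Lie_op], so
    it satisfies [Lie_op] as well. Having weight [a + b], it equals its component of that weight;
    [a + b != 0] excludes the part commuting with the torus. *)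
Lemma rop_bracket a b : a \in roots D -> b \in roots D -> a + b != 0 ->
  exists c : k, rop a *m rop b - rop b *m rop a = c *: rop (a + b) /\
    (a + b \notin roots D -> c = 0).
Proof.
move=> aD bD ab0.
set X := _ - _.
have LieX : Lie_op X.
  pose Q := pmx V (xroot G a); pose Qm := map_mx (comp_poly (- 'X)) Q.
  pose F := Q *m map_mx polyC (rop b) *m Qm.
  have -> : X = map_mx (coefp 1) F.
    have Qm0 : map_mx (coefp 0) Qm = 1%:M.
      rewrite -(pmx_coef0 V (xroot G a)); apply/matrixP => i j; rewrite !mxE /coefp.
      by rewrite -/Q -!horner_coef0 horner_comp !hornerE oppr0 ?mulrN1.
    have Qm1 : map_mx (coefp 1) Qm = - rop a.
      apply/matrixP => i j; rewrite !mxE /coefp.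
      have c1 (p : {poly k}) : p`_1 = p^`().[0] by rewrite horner_coef0 coef_deriv.
      by rewrite !c1 deriv_comp derivN derivX hornerM horner_comp !hornerE oppr0 ?mulrN1.
    have bC m : map_mx (coefp m) (map_mx polyC (rop b)) = if m == 0 then rop b else 0.
      by apply/matrixP => i j; rewrite !mxE /coefp coefC; case: m => [|m]; rewrite !mxE.
    rewrite /F coefp1_mul coefp1_mul Qm0 Qm1 [map_mx (coefp 0) (_ *m _)]coef_pmx_vec.
    by rewrite !bC /= mulmx0 addr0 mulmx1 /Q pmx_coef0 mul1mx mulmxN.
  apply: (poly_mx_coef_closed char0).
  - exact: Lie_op0.
  - by move=> c M N; apply: Lie_op_lin.
  move=> c _; have := Lie_op_conj a b c; congr Lie_op.
  rewrite /F !map_mxM; congr (_ *m _ *m _); apply/matrixP => i j; rewrite !mxE /horner_eval.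
    by exact/esym/hornerC.
  by rewrite /= /horner_eval horner_comp !hornerE.
have [B [c [tB eX]]] := LieX.
(* One term if [a + b] is a root, an empty sum otherwise. *)
exists (\sum_(r <- roots D | r == a + b) c r); split; last first.
  move=> abD; rewrite big_seq_cond big_pred0 // => r; apply/negbTE/negP => /andP[rD /eqP e].
  by rewrite -e rD in abD.
apply/eqP; rewrite -subr_eq0; apply/eqP.
(* [None] carries [B], with trivial character. The term at [a + b] is replaced by 0, having been
   moved to the left-hand side. *)
pose y (i : option 'rV[int]_(rk D)) := if i is Some r then
  if (r != a + b) && (r \in roots D) then c r *: rop r else 0 else B.
pose chi (i : option 'rV[int]_(rk D)) (t : torus k (rk D) k^o) : k :=
  if i is Some r then character r t else 1.
apply: (@eigen_independent k n (torus k (rk D) k^o) _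
  (fun t => krep V (maxtorus G _ t)) (fun t => krep V (ginv (maxtorus G _ t)))
  (None :: [seq Some r | r <- roots D]) y chi _ (fun t => character (a + b) t)).
- move=> t; rewrite mulmxBr mulmxBl scalerBr; congr (_ - _).
    rewrite /X mulmxBr mulmxBl scalerBr characterD.
    have conjM M N : krep V (maxtorus G _ t) *m (M *m N) *m krep V (ginv (maxtorus G _ t)) =
       (krep V (maxtorus G _ t) *m M *m krep V (ginv (maxtorus G _ t))) *m
       (krep V (maxtorus G _ t) *m N *m krep V (ginv (maxtorus G _ t))).
      by rewrite !mulmxA -(mulmxA _ _ (krep V (maxtorus G _ t))) krepVl mulmx1.
    rewrite !conjM !torus_rop_conj // -!scalemxAl -!scalemxAr !scalerA.
    by rewrite [character b t * _]mulrC.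
  have [abD|abD] := boolP (a + b \in roots D).
    by rewrite -scalemxAr -scalemxAl torus_rop_conj // !scalerA mulrC.
  rewrite big_seq_cond big_pred0 ?scale0r ?mulmx0 ?mul0mx ?scaler0 // => r.
  by apply/negbTE/negP => /andP[rD /eqP e]; rewrite -e rD in abD.
- case=> [r|] t /=; last by rewrite tB -mulmxA krepVr mulmx1 scale1r.
  case: andP => [[_ rD]|_]; last by rewrite mulmx0 mul0mx scaler0.
  by rewrite -scalemxAr -scalemxAl torus_rop_conj // !scalerA mulrC.
- case=> [r|] /=; first case: andP => [[rab _]|_]; [right | by left | right].
    exact: character_sep.
  have /(character_sep char0)[t] : 0 != a + b by rewrite eq_sym.
  exists t; rewrite /chi; suff <- : character 0 t = 1 :> k by [].
  by rewrite character_expz big1 // => i _; rewrite mxE expr0z.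
rewrite big_cons big_map eX -addrA; congr (_ + _).
rewrite [X in _ - X *: _]big_mkcond scaler_suml -sumrB big_seq [RHS]big_seq; apply: eq_bigr => r rD.
rewrite /= rD andbT; case: eqVneq => [->|_]; first by rewrite subrr.
by rewrite scale0r subr0.
Qed.

End RootOperators.

(** * Identities in SL2 and the action of an opposite pair of roots *)

Section SL2Identities.
Variable k : fieldType.

Lemma mx2_mul (a b c d a' b' c' d' : k^o) :
  mx2 a b c d *m mx2 a' b' c' d' =
  mx2 (a * a' + b * c') (a * b' + b * d') (c * a' + d * c') (c * b' + d * d').
Proof.
apply/matrixP => i j; rewrite !mxE !big_ord_recl big_ord0 addr0 !mxE /=.
by case: ifP; case: ifP.
Qed.

(** The Weyl element with rows (0, 1) and (-1, 0). *)
Definition SL2_weyl : SL2 k k^o :=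
  gmul (gmul (upper (1 : k^o)) (lower (-1 : k^o))) (upper (1 : k^o)).

Definition gm_pt (s : k) (s0 : s != 0) : torus k 1 k^o :=
  torus_mk (fun _ : 'I_1 => mulfV s0 : (s : k^o) * (s^-1 : k^o) = 1).

Lemma SL2_upper_weyl (u : k) :
  gmul SL2_weyl (upper (u : k^o)) = gmul (lower (- u : k^o)) SL2_weyl.
Proof.
apply: val_inj; rewrite /= !mx2_mul.
by congr mx2; ring.
Qed.

(** The Bruhat decomposition of a nontrivial lower unipotent matrix. *)
Lemma SL2_big_cell (s : k) (s0 : s != 0) (ms0 : - s != 0) :
  lower (s : k^o) = gmul (gmul (upper (s^-1 : k^o)) SL2_weyl)
                         (gmul (diag (gm_pt ms0)) (upper (s^-1 : k^o))).
Proof.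
apply: val_inj; rewrite /= !mx2_mul tval_mk /tinv /= mxE.
by congr mx2; field; rewrite ?oppr_eq0 ?s0 ?oner_eq0.
Qed.

(** A diagonal matrix is a product of two Weyl representatives, hence acts trivially once both
    unipotent subgroups do. *)
Lemma SL2_diag (s : k) (s0 : s != 0) :
  diag (gm_pt s0) =
  gmul (gmul (gmul (upper (s : k^o)) (lower (- s^-1 : k^o))) (upper (s : k^o)))
       (gmul (gmul (upper (-1 : k^o)) (lower (1 : k^o))) (upper (-1 : k^o))).
Proof.
apply: val_inj; rewrite /= !mx2_mul tval_mk /tinv /= mxE.
by congr mx2; field; rewrite ?oppr_eq0 ?s0 ?oner_eq0.
Qed.

End SL2Identities.

Section RootSL2.
Variables (k : fieldType) (char0 : [pchar k] =i pred0).
Variables (D : root_datum) (G : split_group k D) (n : nat) (V : representation G n).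

Lemma krep_triv a p (y : 'M[k]_(n, p)) (u : k) :
  rop V a *m y = 0 -> krep V (xroot G a k^o u) *m y = y.
Proof.
by move=> /(one_param_triv char0 (u : k^o)); rewrite !ext_scalar.
Qed.

(** Converse of [krep_triv]: the polynomial vector [pmx] times [y] agrees with the constant [y] at
    all nonzero scalars, so its linear coefficient vanishes. *)
Lemma rop_fixed a p (y : 'M[k]_(n, p)) :
  (forall u : k, u != 0 -> krep V (xroot G a k^o u) *m y = y) -> rop V a *m y = 0.
Proof.
move=> xy; suff e : pmx V (xroot G a) *m map_mx polyC y = map_mx polyC y.
  rewrite -[LHS]coef_pmx_vec e; apply/matrixP => i j.
  by rewrite !mxE /coefp coefC.
apply/matrixP => i j; apply: (poly_ext_neq0 char0) => c c0.
have := congr1 (fun M : 'M_(n, p) => M i j) (xy c c0).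
rewrite krep_one_param [map_mx polyC y i j]mxE hornerC => <-; rewrite !mxE horner_sum.
by apply: eq_bigr => l _; rewrite hornerM !mxE hornerC.
Qed.

Section OneRoot.
Variables (a : 'rV[int]_(rk D)) (aD : a \in roots D).

Definition coroot_pt s (s0 : s != 0 :> k) : G k^o :=
  maxtorus G _ (cocharacter (coroot a) (gm_pt s0)).

(* The orbit map of [y] factors through the projective line, hence is constant. *)
Lemma rop_opp_fixed (y : 'cV[k]_n) : rop V a *m y = 0 ->
  (forall s (s0 : s != 0), krep V (coroot_pt s0) *m y = y) ->
  rop V (- a) *m y = 0.
Proof.
move=> ay ty; have [phi [c [c0 phiU phiL phiD]]] := sgroup_SL2 G aD.
pose w := krep V (phi _ (SL2_weyl k)).
have lowerE s : s != 0 ->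
    krep V (xroot G (- a) k^o (c * s)) *m y = krep V (xroot G a k^o s^-1) *m (w *m y).
  move=> s0; have ms0 : - s != 0 by rewrite oppr_eq0.
  rewrite -[c * s]/(c *: (s : k^o)) -phiL (SL2_big_cell s0 ms0) !hom_mul !krepM.
  rewrite /w !hom_mul !krepM !phiU phiD -!mulmxA [krep _ _ *m y]krep_triv //.
  by rewrite -/(coroot_pt ms0) ty.
apply/matrixP => i j; rewrite [RHS]mxE ord1 -[rop _ _ *m y]coef_pmx_vec mxE /coefp.
set p := _ i 0; pose q := (pmx V (xroot G a) *m map_mx polyC (w *m y)) i 0.
have polyE b z u : ((pmx V (xroot G b) *m map_mx polyC z : 'cV_n) i 0).[u]
    = (krep V (xroot G b k^o u) *m z) i 0.
  rewrite krep_one_param !mxE horner_sum.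
  by apply: eq_bigr => l _; rewrite hornerM !mxE hornerC.
(* With [u = c * s] the parameter in the opposite root subgroup, [s^-1 = c / u]; this is why [q] is
   composed with [c *: 'X]. *)
apply: nth_default; apply: (@poly_inv_const k char0 _ (q \Po (c *: 'X))) => u u0.
have := lowerE (u / c); rewrite mulf_neq0 ?invr_eq0 // mulrC divfK // => /(_ isT).
move/matrixP/(_ i 0); rewrite -!polyE -/p -/q => ->.
by rewrite horner_comp !hornerE invfM invrK mulrC.
Qed.

(** If [x_a] acts trivially, so does the opposite root subgroup, by conjugation with the Weyl
    element, and then so does the image of the diagonal torus. *)
Lemma rop_eq0_SL2 : rop V a = 0 -> rop V (- a) = 0 /\
  (forall s (s0 : s != 0), krep V (coroot_pt s0) = 1%:M).
Proof.
move=> a0; have [phi [c [c0 phiU phiL phiD]]] := sgroup_SL2 G aD.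
have xa u : krep V (xroot G a k^o u) = 1%:M.
  by rewrite -[LHS]mulmx1 krep_triv // a0 mul0mx.
have xma u : krep V (xroot G (- a) k^o u) = 1%:M.
  (* The parameter [u / c] compensates the constant [c] in [sgroup_SL2]. *)
  have : krep V (phi _ (gmul (SL2_weyl k) (upper (- (u / c) : k^o)))) =
      krep V (phi _ (gmul (lower (u / c : k^o)) (SL2_weyl k))).
    by rewrite SL2_upper_weyl opprK.
  rewrite (hom_mul phi (SL2_weyl k)) (hom_mul phi (lower _)) !krepM phiU xa mulmx1 phiL.
  rewrite [_ *: _](_ : _ = u); last by rewrite /= -[LHS]/(c * (u / c)) mulrC divfK.
  move/(congr1 (mulmx^~ (krep V (ginv (phi _ (SL2_weyl k)))))).
  by rewrite -mulmxA krepVr mulmx1 => <-.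
split.
  by rewrite -[LHS]mulmx1; apply: rop_fixed => u _; rewrite xma mul1mx.
move=> s s0; rewrite /coroot_pt -phiD SL2_diag !hom_mul !krepM !phiU !phiL !xa !xma.
by rewrite !mulmx1.
Qed.
End OneRoot.
End RootSL2.

(** * Roots inside and outside the Levi subsystem *)

Section RootCombinatorics.
Variables (D : root_datum) (l : nat) (Delta : 'I_l -> 'rV[int]_(rk D)).
Hypothesis hDelta : simple_roots Delta.
Implicit Types (c d : 'I_l -> int) (rho sigma : 'rV[int]_(rk D)).

Definition comb c := \sum_i Delta i *~ c i.

Lemma combD c d : comb c + comb d = comb (fun i => c i + d i).
Proof. by rewrite /comb -big_split; apply: eq_bigr => i _; rewrite mulrzDr. Qed.

Lemma combN c : - comb c = comb (fun i => - c i).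
Proof. by rewrite /comb -sumrN; apply: eq_bigr => i _; rewrite mulrNz. Qed.

Lemma comb_simple i : Delta i = comb (fun j => (j == i)%:Z).
Proof.
by rewrite /comb (bigD1 i) //= eqxx big1 ?addr0 // => j /negbTE ->.
Qed.

Lemma comb_inj c d : comb c = comb d -> c =1 d.
Proof.
move=> e i; apply/eqP; rewrite -subr_eq0; apply/eqP.
apply: (simple_free hDelta (c := fun i => c i - d i)) i.
by rewrite -[LHS]/(comb _) -(combD c (fun i => - d i)) -combN e subrr.
Qed.

Lemma root_comb rho : rho \in roots D -> exists c, rho = comb c.
Proof.
move=> /(simple_gen hDelta)[c [->|->]]; [exists (fun i => (c i)%:Z)|exists (fun i => - (c i)%:Z)].
  by apply: eq_bigr => i _; rewrite pmulrn.
by rewrite -sumrN; apply: eq_bigr => i _; rewrite mulrNz pmulrn.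
Qed.

Lemma comb_sign c : comb c \in roots D -> (forall i, 0 <= c i) \/ (forall i, c i <= 0).
Proof.
move=> /(simple_gen hDelta)[d [e|e]]; [left | right] => i.
  by rewrite (@comb_inj c (fun i => (d i)%:Z)).
rewrite (@comb_inj c (fun i => - (d i)%:Z)) ?oppr_le0 // e -combN.
by congr (- _).
Qed.

Lemma positive_comb c : (forall i, 0 <= c i) -> comb c \in roots D ->
  positive_root Delta (comb c).
Proof.
move=> c0 cD; split=> //; exists (fun i => `|c i|%N).
by apply: eq_bigr => i _; rewrite pmulrn gez0_abs.
Qed.

Lemma pairing_comb c y : pairing (comb c) y = \sum_i c i * pairing (Delta i) y.
Proof.
rewrite /pairing; under [RHS]eq_bigr => i _ do rewrite mulr_sumr.
rewrite [RHS]exchange_big; apply: eq_bigr => j _.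
rewrite /comb summxE mulr_suml; apply: eq_bigr => i _.
by rewrite -scaler_int mxE intz mulrA.
Qed.

Lemma pairingDl (x y z : 'rV[int]_(rk D)) : pairing (x + y) z = pairing x z + pairing y z.
Proof. by rewrite /pairing -big_split; apply: eq_bigr => i _; rewrite mxE mulrDl. Qed.

Lemma root_neq0 rho : rho \in roots D -> rho != 0.
Proof.
move=> rD; apply: contra_eq_neq (pairing_coroot rD) => ->.
by rewrite /pairing big1 // => i _; rewrite mxE mul0r.
Qed.

Lemma root_opp rho : rho \in roots D -> - rho \in roots D.
Proof.
move=> rD; have := roots_reflection rD rD; rewrite pairing_coroot //.
by rewrite -[X in _ - X]/(rho + rho) opprD addrA subrr add0r.
Qed.

Variables beta delta : 'I_l.
Let J := component Delta beta delta.

Definition levi_root rho := rho \in roots D /\ delta_height Delta beta delta rho 0.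

(** Since coefficients of a root have constant sign, these are the positive roots outside the Levi
    subsystem. In this form stability under adding Levi roots is visible: the coefficient at [i]
    does not change. *)
Definition outer_root rho := rho \in roots D /\
  exists2 c, rho = comb c & exists2 i, i \notin J & 0 < c i.

(** The coefficients have constant sign, so a zero sum of some of them forces each of these to
    vanish. *)
Lemma levi_rootP c : comb c \in roots D ->
  levi_root (comb c) <-> (forall i, i \notin J -> c i = 0).
Proof.
move=> cD; split=> [[_ [d /comb_inj cd ht]] i iJ|c0]; last first.
  by split=> //; exists c; rewrite // big1.
have [c0|c0] := comb_sign cD.
  move/esym/eqP: ht; rewrite psumr_eq0; last by move=> j _; rewrite -cd.
  by move/allP/(_ i (mem_index_enum i)); rewrite iJ -cd => /eqP.
move/esym/eqP: ht; rewrite -oppr_eq0 -sumrN psumr_eq0; last by move=> j _; rewrite -cd oppr_ge0.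
by move/allP/(_ i (mem_index_enum i)); rewrite iJ -cd oppr_eq0 => /eqP.
Qed.

Lemma positive_levi_outer rho : positive_root Delta rho -> levi_root rho \/ outer_root rho.
Proof.
move=> [rD [c ec]]; pose d i := (c i)%:Z.
have ed : rho = comb d by rewrite ec; apply: eq_bigr => i _; rewrite pmulrn.
have [/forallP c0|] := boolP [forall i, (i \notin J) ==> (c i == 0)].
  left; rewrite ed; apply/levi_rootP; first by rewrite -ed.
  by move=> i iJ; have := c0 i; rewrite iJ /= /d => /eqP ->.
rewrite negb_forall => /existsP[i]; rewrite negb_imply => /andP[iJ ci].
by right; split=> //; exists d => //; exists i; rewrite // /d ltz_nat lt0n.
Qed.

Lemma outer_positive rho : outer_root rho -> positive_root Delta rho.
Proof.
move=> [rD [c ec [i _ ci]]]; rewrite ec in rD *; apply: positive_comb => //.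
have [//|/(_ i)] := comb_sign rD; by rewrite leNgt ci.
Qed.

Lemma outer_add_levi rho sigma : outer_root rho -> levi_root sigma ->
  rho + sigma != 0 /\ (rho + sigma \in roots D -> outer_root (rho + sigma)).
Proof.
move=> [rD [c ec [i iJ ci]]] sL; have [sD _] := sL.
have [d ed] := root_comb sD.
have d0 : d i = 0 by rewrite ed in sD sL; move/levi_rootP: sL => ->.
split; last first.
  move=> rsD; split=> //; exists (fun i => c i + d i); first by rewrite ec ed combD.
  by exists i => //; rewrite d0 addr0.
apply/eqP; rewrite ec ed combD => e.
have := @comb_inj (fun i => c i + d i) (fun=> 0).
rewrite e /comb big1 => [/(_ erefl i)|j _]; last by rewrite mulr0z.
by rewrite d0 addr0 => e0; rewrite e0 ltxx in ci.
Qed.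

Lemma simple_outer i : i \notin J -> outer_root (Delta i).
Proof.
move=> iJ; split; first exact: simple_root.
exists (fun j => (j == i)%:Z); first exact: comb_simple.
by exists i; rewrite ?eqxx.
Qed.

Lemma simple_opp_levi i : i \in J -> levi_root (- Delta i).
Proof.
move=> iJ; have := root_opp (simple_root hDelta i); rewrite comb_simple combN => rD.
by apply/levi_rootP => // j jJ; case: eqVneq => // e; rewrite e iJ in jJ.
Qed.

Lemma component_notin_delta : delta \notin J.
Proof.
rewrite /J /component; case: eqVneq => [_|db]; first by rewrite inE.
rewrite inE; apply/negP => /connectP[p pth e]; move: db.
by case/lastP: p pth e => [|p y] /=;
  [move=> _ -> | rewrite rcons_path last_rcons => /andP[_ /and3P[_ _ yd]] e; rewrite e eqxx in yd];
  rewrite ?eqxx.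
Qed.

(** Otherwise an edge from [i] to [j] avoiding [delta] would put [j] in the component. *)
Lemma component_closed i j : i \in J -> j \notin J -> j != delta ->
  pairing (Delta i) (coroot (Delta j)) = 0.
Proof.
move=> iJ jJ jd; have id : i != delta.
  by apply: contraNneq component_notin_delta => <-.
apply/eqP; apply: contraNT jJ => pij.
have [->//|ij] := eqVneq j i.
move: iJ; rewrite /J /component; case: ifP => _; rewrite !inE // => bi.
apply: (connect_trans bi); apply: connect1.
by rewrite /dynkin /= id jd eq_sym ij pij.
Qed.

(* Reflecting [sigma - Delta i] in [Delta i] gives [sigma + Delta i], and these
   two cannot both have coefficients of constant sign. *)
Lemma simple_opp_add_levi i sigma : i \notin J -> i != delta -> levi_root sigma ->
  - Delta i + sigma != 0 /\ - Delta i + sigma \notin roots D.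
Proof.
move=> iJ id sL; have [sD _] := sL; have [d ed] := root_comb sD.
have d0 j : j \notin J -> d j = 0 by rewrite ed in sD sL; move/levi_rootP: sL; apply.
have di := d0 i iJ.
have e1 : - Delta i + sigma = comb (fun j => - (j == i)%:Z + d j).
  by rewrite {1}comb_simple combN ed combD.
split.
  apply/eqP => e; have := @comb_inj (fun j => - (j == i)%:Z + d j) (fun=> 0).
  rewrite -e1 e /comb big1 => [/(_ erefl i)|j _]; last by rewrite mulr0z.
  by rewrite eqxx di.
apply/negP => rD; have iD := simple_root hDelta i.
have := roots_reflection iD rD; rewrite pairingDl.
have -> : pairing sigma (coroot (Delta i)) = 0.
  rewrite ed pairing_comb big1 // => j _.
  have [jJ|jJ] := boolP (j \in J); last by rewrite d0 // mul0r.
  by rewrite (component_closed jJ iJ id) mulr0.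
have -> : pairing (- Delta i) (coroot (Delta i)) = -2.
  have : pairing (Delta i - Delta i) (coroot (Delta i)) = 0.
    by rewrite subrr /pairing big1 // => j _; rewrite mxE mul0r.
  by rewrite pairingDl pairing_coroot // => /eqP; rewrite addrC addr_eq0 => /eqP.
have -> : - Delta i + sigma - Delta i *~ (-2 + 0) = comb (fun j => (j == i)%:Z + d j).
  rewrite addr0 mulrNz opprK -combD -comb_simple -ed addrAC; congr (_ + _).
  by rewrite -[Delta i *~ 2]/(Delta i + Delta i) addrA addNr add0r.
move=> sD2; rewrite e1 in rD.
(* The coefficients at [i] are -1 and 1, so the two roots force all [d j <= 0] and all [d j >= 0].
   Then [sigma = 0], which is not a root. *)
have sd : forall j, d j = 0.
  move=> j; have [jJ|] := boolP (j \in J); last exact: d0.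
  have ji : (j == i) = false by apply: contraNF iJ => /eqP <-.
  have [/(_ i)|/(_ j)] := comb_sign rD; rewrite ?eqxx ?ji ?di //.
  have [/(_ j)|/(_ i)] := comb_sign sD2; rewrite ?eqxx ?ji ?di // !add0r => ge le.
  by apply/eqP; rewrite eq_le ge le.
have := root_neq0 sD; rewrite ed /comb big1 ?eqxx // => j _.
by rewrite sd mulr0z.
Qed.

End RootCombinatorics.

Lemma character_gm_pt (k : fieldType) r (x y : 'rV[int]_r) (s : k) (s0 : s != 0) :
  character x (cocharacter y (gm_pt s0)) = s ^ pairing x y.
Proof.
have expz_sum (F : 'I_r -> int) : s ^ (\sum_i F i) = \prod_i s ^ F i.
  apply: (big_morph (fun z => s ^ z)); last exact: expr0z.
  by move=> a b; rewrite expfzDr.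
rewrite character_expz expz_sum; apply: eq_bigr => i _.
transitivity ((s ^ y 0 i) ^ x 0 i); last by rewrite exprz_exp mulrC.
rewrite tval_mk zpow_expz; last exact: (tvalV (gm_pt s0) ord0).
by rewrite tval_mk.
Qed.

(** * The span of the Levi operators applied to the highest weight vector *)

Section Main.
Variables (k : fieldType) (char0 : [pchar k] =i pred0).
Variables (D : root_datum) (G : split_group k D).
Variables (l : nat) (Delta : 'I_l -> 'rV[int]_(rk D)) (hDelta : simple_roots Delta).
Variables (beta : 'I_l) (w : 'rV[int]_(rk D)) (hw : fundamental_weight Delta beta w).
Variables (n : nat) (V : representation G n).
Variables (v : 'cV[k]_n) (hv : highest_weight_vector Delta V w v).
Variable delta : 'I_l.

(** Words in the root operators replace the orbit of the group, so that properties of the span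
    follow by induction on the word. *)
Inductive levi_orbit : 'cV[k]_n -> Prop :=
| levi_orbit_hw : levi_orbit v
| levi_orbit_rop sigma x : levi_root Delta beta delta sigma -> levi_orbit x ->
    levi_orbit (rop V sigma *m x).

Lemma levi_orbit_torus x : levi_orbit x -> forall R (t : torus k (rk D) R),
  exists chi : R, V R (maxtorus G R t) *m vec_ext R x = chi *: vec_ext R x.
Proof.
elim=> [|sigma y [sD _] _ IH] R t; first by exists (character w t); apply: hwv_weight hv _ _.
have [chi e] := IH R t; exists (character sigma t * chi).
rewrite -[vec_ext R _]/(ext R (_ *m _)) extM mulmxA torus_rop //.
by rewrite -scalemxAl -mulmxA [_ *m ext R y]e -scalemxAr scalerA.
Qed.

(** Moving [rop V rho] past [rop V sigma] produces a multiple of the operator of [rho + sigma],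
    again outer if it is a root; hence the induction is uniform in [rho]. *)
Lemma outer_rop_levi_orbit x : levi_orbit x ->
  forall rho, outer_root Delta beta delta rho -> rop V rho *m x = 0.
Proof.
elim=> [|sigma y sL _ IH] rho rO.
  apply: (rop_fixed char0) => u _.
  rewrite -krep_vec; have rpos := outer_positive hDelta rO.
  rewrite (hwv_fixed hv rpos); last by exists u.
  by rewrite -[vec_ext _ _]/(ext k^o v) ext_scalar.
have [rs0 rsO] := outer_add_levi hDelta rO sL.
have [c [e c0]] := rop_bracket char0 V (proj1 rO) (proj1 sL) rs0.
have {e} := congr1 (mulmx^~ y) e.
rewrite mulmxBl -!mulmxA (IH rho rO) mulmx0 subr0 => ->.
have [/rsO rsO'|/c0 ->] := boolP (rho + sigma \in roots D).
  by rewrite -scalemxAl IH // scaler0.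
by rewrite scale0r mul0mx.
Qed.

Lemma krep_weight (t : torus k (rk D) k^o) :
  krep V (maxtorus G _ t) *m v = character w t *: v.
Proof.
by rewrite -krep_vec (hwv_weight hv) -[vec_ext _ _]/(ext k^o v) ext_scalar.
Qed.

Lemma beta_in_component : delta != beta -> beta \in component Delta beta delta.
Proof. by rewrite /component => /negbTE ->; rewrite inE connect0. Qed.

(** Here [i != beta], so the coroot of [i] fixes [v] and SL2 shows that [rop V (- Delta i)] kills
    [v]. It commutes with all operators of Levi roots. *)
Lemma simple_opp_rop_levi_orbit i : i \notin component Delta beta delta ->
  i != delta -> forall x, levi_orbit x -> rop V (- Delta i) *m x = 0.
Proof.
move=> iJ id x; have iD := simple_root hDelta i.
have ib : i != beta.
  by apply: contraNneq iJ => ib; rewrite ib beta_in_component // eq_sym -ib.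
elim=> [|sigma y sL _ IH].
  have piD : positive_root Delta (Delta i).
    rewrite comb_simple; apply: positive_comb => //; by rewrite -comb_simple.
  apply: (rop_opp_fixed char0) => //.
    apply: (rop_fixed char0) => u _.
    rewrite -krep_vec (hwv_fixed hv piD); last by exists u.
    by rewrite -[vec_ext _ _]/(ext k^o v) ext_scalar.
  move=> s s0; rewrite /coroot_pt krep_weight character_gm_pt hw (negbTE ib).
  by rewrite expr0z scale1r.
have [s0 sN] := simple_opp_add_levi hDelta iJ id sL.
have [c [e /(_ sN) c0]] := rop_bracket char0 V (root_opp iD) (proj1 sL) s0.
move: e; rewrite c0 scale0r => /subr0_eq e.
by rewrite mulmxA e -mulmxA IH mulmx0.
Qed.

Section StableSpan.
Variable U : {vspace 'cV[k]_n}.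
(** These two properties characterize [U] as the span of [levi_orbit]. *)
Hypothesis orbitU : forall x, levi_orbit x -> x \in U.
Hypothesis U_ind : forall P : 'cV[k]_n -> Prop, P 0 ->
  (forall c x y, P x -> P y -> P (c *: x + y)) ->
  (forall x, levi_orbit x -> P x) -> forall x, x \in U -> P x.

Lemma span_stable (M : 'M[k]_n) :
  (forall x, levi_orbit x -> M *m x \in U) -> forall x, x \in U -> M *m x \in U.
Proof.
move=> MU; apply: U_ind => //; first by rewrite mulmx0 mem0v.
by move=> c x y Mx My; rewrite mulmxDr -scalemxAr memvD ?memvZ.
Qed.

Lemma xroot_stab rho R (u : Ga k R) :
  (forall x, levi_orbit x -> rop V rho *m x \in U) ->
  stab V U (xroot G rho R u).
Proof.
move=> /span_stable rU; split=> z; first exact: (one_param_stable char0).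
rewrite (@repV_eq _ _ _ V _ _ (V R (xroot G rho R (- u : R)))).
  exact: (one_param_stable char0).
by rewrite -repM -hom_mul /= addNr (hom_one (xroot G rho)) rep1.
Qed.

Lemma levi_xroot_stab rho R (u : Ga k R) :
  levi_root Delta beta delta rho -> stab V U (xroot G rho R u).
Proof. by move=> rL; apply: xroot_stab => x Ox; apply/orbitU/levi_orbit_rop. Qed.

Lemma torus_in_ext R (t : torus k (rk D) R) z :
  in_ext U z -> in_ext U (V R (maxtorus G R t) *m z).
Proof.
move: z; apply: stable_in_ext; apply: U_ind.
- by rewrite -[vec_ext R 0]/(ext R _) ext0 mulmx0; apply: in_ext0.
- move=> c x y Ux Uy; rewrite -[vec_ext R _]/(ext R _) extD extZ mulmxDr -scalemxAr.
  exact: in_ext_lin.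
move=> x Ox; have [chi ->] := levi_orbit_torus Ox t.
rewrite -[_ *: _]addr0; apply: in_ext_lin; last exact: in_ext0.
exact/in_ext_mem/orbitU.
Qed.

Lemma torus_stab R (t : torus k (rk D) R) : stab V U (maxtorus G R t).
Proof.
split=> z; first exact: torus_in_ext.
rewrite (@repV_eq _ _ _ V _ _ (V R (maxtorus G R (ginv t)))).
  exact: torus_in_ext.
by rewrite -repM -hom_mul gmulV (hom_one (maxtorus G)) rep1.
Qed.

Lemma parabolic_stabilizes : stabilizes V (parabolic Delta delta) U.
Proof.
move=> R g Pg; suff [] : stab V U g by [].
move: R g Pg; apply: generated_stabilizes => R g [|[i id [u ->]]].
  move: R g; apply: generated_stabilizes => R g [[t ->]|[rho rpos [u ->]]].
    exact: torus_stab.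
  (* Levi roots preserve [U] by construction, outer roots kill it. *)
  have [/levi_xroot_stab//|rO] := positive_levi_outer hDelta beta delta rpos.
  by apply: xroot_stab => x Ox; rewrite outer_rop_levi_orbit ?mem0v.
have [iJ|iJ] := boolP (i \in component Delta beta delta).
  exact/levi_xroot_stab/simple_opp_levi.
by apply: xroot_stab => x Ox; rewrite simple_opp_rop_levi_orbit ?mem0v.
Qed.

Lemma Lsub_stab R (g : G R) : Lsub Delta beta delta g -> stab V U g.
Proof.
move: R g; apply: generated_stabilizes => R g [rho [rD ht [u ->]]].
exact: levi_xroot_stab.
Qed.

(* The vectors all of whose translates by L lie in [W] are stable under the
   operators of the roots of L, because L contains their root subgroups. *)
Lemma levi_orbit_sub (W : {vspace 'cV[k]_n}) :
  (forall R (g : G R), Lsub Delta beta delta g -> in_ext W (V R g *m vec_ext R v)) ->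
  forall x, levi_orbit x -> x \in W.
Proof.
move=> LW x Ox; suff LWx R (g : G R) : Lsub Delta beta delta g ->
    in_ext W (V R g *m vec_ext R x).
  apply: mem_in_ext; have := LWx _ (gone G k^o).
  by rewrite rep1 mul1mx; apply=> H Hcl _; apply: closed_one.
elim: Ox R g => [|sigma y sL _ IH] R g Lg; first exact: LW.
apply: (dact_closed char0 (x := xroot G sigma) (P := fun z => in_ext W (V R g *m z))).
- by rewrite mulmx0; apply: in_ext0.
- by move=> c z z' Wz Wz'; rewrite mulmxDr -scalemxAr; apply: in_ext_lin.
move=> c _; rewrite mulmxA -repM; apply: IH.
move=> H Hcl LH; apply: (closed_mul Hcl); first exact: Lg.
by apply: LH; exists sigma; case: sL => sD ht; split=> //; exists c%:A.
Qed.

(** [U] is stable under L and contains [v], so it contains the orbit; conversely any subspace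
    containing the orbit contains [U], by [levi_orbit_sub]. *)
Lemma span_Vsub x : x \in U <-> Vsub Delta V beta delta v x.
Proof.
split=> [xU W LW|].
  move: x xU; apply: U_ind; first exact: mem0v.
    by move=> c x y xW yW; rewrite memvD ?memvZ.
  exact: levi_orbit_sub.
apply=> R g /Lsub_stab[gU _]; apply: gU.
exact/in_ext_mem/orbitU/levi_orbit_hw.
Qed.

Lemma coroot_two_triv i : rop V (Delta i) = 0 ->
  krep V (coroot_pt G (Delta i) (char0_natS_neq0 char0 1)) = 1%:M.
Proof. by move=> i0; have [] := rop_eq0_SL2 char0 (simple_root hDelta i) i0. Qed.

(** The value at 2 of the coroot of [j] acts trivially, yet conjugation by it multiplies
    [rop V (Delta i)] by a nonzero power of 2, which differs from 1. *)
Lemma rop_eq0_dynkin i j : dynkin Delta i j ->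
  rop V (Delta j) = 0 -> rop V (Delta i) = 0.
Proof.
move=> /andP[_ pij] /coroot_two_triv tj.
have := torus_rop_conj char0 V (cocharacter (coroot (Delta j))
  (gm_pt (char0_natS_neq0 char0 1))) (simple_root hDelta i).
rewrite -[maxtorus _ _ _]/(coroot_pt G _ _) tj mul1mx character_gm_pt.
have -> : krep V (ginv (coroot_pt G (Delta j) (char0_natS_neq0 char0 1))) = 1%:M.
  by rewrite -[LHS]mulmx1 -tj krepVl.
rewrite mulmx1 => /esym/eqP; rewrite -subr_eq0 -{2}[rop _ _]scale1r -scalerBl.
rewrite scaler_eq0 => /orP[|/eqP//]; rewrite subr_eq0 => /eqP /(expz2_inj char0).
by move/eqP; rewrite (negbTE pij).
Qed.

Lemma span_proper : connect (dynkin Delta) beta delta -> U != fullv.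
Proof.
move=> bd; apply/eqP => Ufull.
have d0 : rop V (Delta delta) = 0.
  have dO := simple_outer hDelta (component_notin_delta Delta beta delta).
  have kill (x : 'cV_n) : rop V (Delta delta) *m x = 0.
    have : x \in U by rewrite Ufull memvf.
    move: x; apply: U_ind; first by rewrite mulmx0.
      by move=> c x y ex ey; rewrite mulmxDr -scalemxAr ex ey scaler0 addr0.
    by move=> x Ox; apply: outer_rop_levi_orbit.
  by apply/matrixP => i j; have /matrixP/(_ i 0) := kill (delta_mx j 0);
    rewrite -colE !mxE.
have b0 : rop V (Delta beta) = 0.
  (* The vanishing at [delta] is carried back along the path to its starting vertex, which is
     generalized from [beta]. *)
  case/connectP: bd => p; elim: p beta => [|j p IH] i /=; first by move=> _ <-.
  by move=> /andP[ij pth] e; apply: rop_eq0_dynkin ij (IH _ pth e).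
(* The value at 2 of the coroot of [beta] multiplies [v] both by 1 and by 2. *)
have := krep_weight (cocharacter (coroot (Delta beta)) (gm_pt (char0_natS_neq0 char0 1))).
rewrite -[maxtorus _ _ _]/(coroot_pt G _ _) coroot_two_triv // mul1mx.
rewrite character_gm_pt hw eqxx expr1z => /eqP.
rewrite -{1}[v]scale1r -subr_eq0 -scalerBl scaler_eq0 (negbTE (hwv_neq0 hv)) orbF.
by rewrite mulrSr opprD addrA subrr add0r oppr_eq0 oner_eq0.
Qed.

End StableSpan.

End Main.

Theorem proposition3p4 (k : fieldType) (char0 : [pchar k] =i pred0)
  (D : root_datum) (Dred : reduced D) (Dss : semisimple D)
  (Dsc : simply_connected D) (G : split_group k D)
  (l : nat) (Delta : 'I_l -> 'rV[int]_(rk D)) (hDelta : simple_roots Delta)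
  (beta : 'I_l) (w : 'rV[int]_(rk D)) (hw : fundamental_weight Delta beta w)
  (n : nat) (V : representation G n) (Virr : irreducible V)
  (v : 'cV[k]_n) (hv : highest_weight_vector Delta V w v) :
  forall delta : 'I_l,
  exists Vdelta : {vspace 'cV[k]_n},
    [/\ forall u, u \in Vdelta <-> Vsub Delta V beta delta v u,
        Vdelta != 0%VS,
        connect (dynkin Delta) beta delta -> Vdelta != fullv &
        stabilizes V (parabolic Delta delta) Vdelta].
Proof.
move=> delta.
have [U [orbitU U_ind]] := span_exists (levi_orbit Delta beta V v delta).
exists U; split.
- exact: (span_Vsub char0 orbitU U_ind).
- apply: contraNneq (hwv_neq0 hv) => U0.
  by rewrite -memv0 -U0; apply/orbitU/levi_orbit_hw.
- exact: (span_proper char0 hDelta hw hv U_ind).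
exact: (parabolic_stabilizes char0 hDelta hw hv orbitU U_ind).
Qed.
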